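(* Every finitely generated simple vigorous group $G \leq \mathrm{Homeo}(\mathfrak{C})$ is generated by three involutions.
   Context: $\mathfrak{C}$ denotes Cantor space and $\mathrm{Homeo}(\mathfrak{C})$ its group of homeomorphisms, acting on the right. A group $G \leq \mathrm{Homeo}(\mathfrak{C})$ is vigorous if for every clopen subset $A$ of $\mathfrak{C}$ and all proper nonempty clopen subsets $B$ and $C$ of $A$ there exists $\gamma \in G$ such that $B\gamma \subseteq C$ and $\gamma$ fixes $\mathfrak{C} \setminus A$ pointwise. An involution is an element of order $2$. *)

(* Defs.v *)
From HB Require Import structures.
From mathcomp Require Import all_boot.
From mathcomp Require Import boolp classical_sets functions cardinality topology cantor.

Set Implicit Arguments.
Unset Strict Implicit.
Unset Printing Implicit Defensive.

Local Open Scope group_scope.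
Local Open Scope classical_set_scope.

Record homeo (T : topologicalType) := Homeo {
  homeo_fun :> T -> T;
  homeo_inv : T -> T;
  homeo_funK : cancel homeo_fun homeo_inv;
  homeo_invK : cancel homeo_inv homeo_fun;
  homeo_continuous : continuous homeo_fun;
  homeo_inv_continuous : continuous homeo_inv }.

Section HomeoGroup.
Variable T : topologicalType.
Implicit Types f g h : homeo T.

Lemma homeo_ext f g : f =1 g -> f = g.
Proof.
case: f g => [f f' fK f'K cf cf'] [g g' gK g'K cg cg'] /= /funext fg.
rewrite -{}fg in gK g'K cg *.
have fg' : f' = g' by apply/funext => x; rewrite -{1}(g'K x) fK.
rewrite -{}fg' in gK g'K cg' *.
by congr Homeo; exact: Prop_irrelevance.
Qed.

HB.instance Definition _ := gen_eqMixin (homeo T).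
HB.instance Definition _ := gen_choiceMixin (homeo T).

Definition homeo_one : homeo T :=
  @Homeo T id id (fun=> erefl) (fun=> erefl)
    (fun=> cvg_id) (fun=> cvg_id).

Definition homeo_inverse f : homeo T :=
  @Homeo T (homeo_inv f) f (@homeo_invK T f) (@homeo_funK T f)
    (@homeo_inv_continuous T f) (@homeo_continuous T f).

(* Homeomorphisms act on the right: the product of [f] and [g] is [f] followed
   by [g]. *)
Definition homeo_mul f g : homeo T :=
  @Homeo T (g \o f) (homeo_inv f \o homeo_inv g)
    (can_comp (@homeo_funK T g) (@homeo_funK T f))
    (can_comp (@homeo_invK T f) (@homeo_invK T g))
    (fun x => continuous_comp (@homeo_continuous T f x)
                              (@homeo_continuous T g (f x)))
    (fun x => continuous_comp (@homeo_inv_continuous T g x)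
                              (@homeo_inv_continuous T f (homeo_inv g x))).

Lemma homeo_mulA : associative homeo_mul.
Proof. by move=> f g h; exact: homeo_ext. Qed.

Lemma homeo_mul1g : left_id homeo_one homeo_mul.
Proof. by move=> f; exact: homeo_ext. Qed.

Lemma homeo_mulg1 : right_id homeo_one homeo_mul.
Proof. by move=> f; exact: homeo_ext. Qed.

Lemma homeo_mulVg : left_inverse homeo_one homeo_inverse homeo_mul.
Proof. by move=> f; apply: homeo_ext => x /=; rewrite homeo_invK. Qed.

Lemma homeo_mulgV : right_inverse homeo_one homeo_inverse homeo_mul.
Proof. by move=> f; apply: homeo_ext => x /=; rewrite homeo_funK. Qed.

HB.instance Definition _ := isGroup.Build (homeo T)
  homeo_mulA homeo_mul1g homeo_mulg1 homeo_mulVg homeo_mulgV.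

End HomeoGroup.

Section SubgroupNotions.
Variable gT : groupType.
Implicit Types (G N S : set gT) (x : gT).

Definition subgroup G := group_closed [in G].

Definition generated S : set gT := smallest subgroup S.

Definition finitely_generated G := exists2 S, finite_set S & generated S = G.

Definition normal_subgroup N G :=
  [/\ subgroup N, N `<=` G & forall x g, N x -> G g -> N (x ^ g)].

Definition simple_group G :=
  G <> [set 1] /\ forall N, normal_subgroup N G -> N = [set 1] \/ N = G.

Definition involution x := x <> 1 /\ x ^+ 2 = 1.

End SubgroupNotions.

Definition vigorous (T : topologicalType) (G : set (homeo T)) :=
  forall A B C : set T, clopen A -> clopen B -> clopen C ->
    B `<` A -> B !=set0 -> C `<` A -> C !=set0 ->
    exists g : homeo T,
      [/\ G g, g @` B `<=` C & forall x, (~` A) x -> g x = x].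

(* Main.v *)
(* A vigorous simple group G contains every commutator of elements of its
   topological full group supported in a common proper clopen set X: an element
   of the full group supported in X extends to an element of G with extra
   support in an arbitrarily chosen part of the complement of X, and disjoint
   extra supports disappear in commutators. Hence G contains all even
   permutations of disjoint copies (under G) of a clopen set, and it is
   generated by the double swaps (12)(34) of such copies, each of which is a
   commutator of two double swaps.

   If the translates of U by the powers w ^ k with 0 <= k < N are disjoint and
   s_1, ..., s_n are involutions supported in U, with 2 ^ n <= N, let c be the
   product of the conjugates of s_i by w ^ (2 ^ i). Since the powers of 2 form
   a Sidon set, the conjugates of c by the w ^ (- 2 ^ i) commute like the s_i on
   U and have otherwise disjoint supports, so that <w, c> contains the derived
   subgroup of <s_1, ..., s_n>. Used inside U, this puts any finite set of
   double swaps supported in U into a group generated by only four elements of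
   order at most 2. Used again with these four elements and with a product
   w = a b of two involutions of G whose powers move U over the whole space
   (so that G is generated by w and the double swaps in U), it shows that a, b
   and c generate G. *)
From mathcomp Require Import all_boot fingroup perm ssralg zmodp finmap zify.
Require Import Defs.
From mathcomp Require Import all_boot.
From mathcomp Require Import boolp classical_sets functions cardinality topology cantor.

Set Implicit Arguments.
Unset Strict Implicit.
Unset Printing Implicit Defensive.

Local Open Scope group_scope.
Local Open Scope classical_set_scope.

(** * Generated subgroups *)

Section Subgroups.
Variable gT : groupType.
Implicit Types (G H S A B : set gT) (x y z s t d e : gT).

Lemma subgroupP G : subgroup G <-> G 1 /\ forall x y, G x -> G y -> G (x * y^-1).
Proof.
split=> [[/set_mem G1 GD]|[G1 GD]]; split=> //; first 1 last.
- exact/mem_set.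
- by move=> x y /set_mem Gx /set_mem Gy; apply/mem_set/GD.
- by move=> x y Gx Gy; apply/set_mem/GD; exact/mem_set.
Qed.

Lemma subgroup1 G : subgroup G -> G 1.
Proof. by move=> /subgroupP[]. Qed.

Lemma subgroupV G x : subgroup G -> G x -> G x^-1.
Proof. by move=> /subgroupP[G1 GD] Gx; rewrite -[x^-1]mul1g; exact: GD. Qed.

Lemma subgroupM G x y : subgroup G -> G x -> G y -> G (x * y).
Proof.
move=> sG Gx Gy; rewrite -[y]invgK; move/subgroupP: (sG) => [_]; apply=> //.
exact: subgroupV.
Qed.

Lemma subgroupX G x n : subgroup G -> G x -> G (x ^+ n).
Proof.
move=> sG Gx; elim: n => [|n IH]; first exact: subgroup1.
by rewrite expgS; exact: subgroupM.
Qed.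

Lemma subgroupJ G x y : subgroup G -> G x -> G y -> G (x ^ y).
Proof.
by move=> sG Gx Gy; do ![apply: subgroupM => //]; exact: subgroupV.
Qed.

Lemma subgroupR G x y : subgroup G -> G x -> G y -> G [~ x, y].
Proof.
by move=> sG Gx Gy; apply: subgroupM => //; [exact: subgroupV|exact: subgroupJ].
Qed.

Lemma subgroup_generated S : subgroup (generated S).
Proof.
apply/subgroupP; split=> [H [/subgroup1 //]|x y Sx Sy H HS].
by move/subgroupP: (HS.1) => [_]; apply; [exact: Sx|exact: Sy].
Qed.

Lemma sub_generated S : S `<=` generated S.
Proof. exact: sub_gen_smallest. Qed.

Lemma generated_sub S H : subgroup H -> S `<=` H -> generated S `<=` H.
Proof. by move=> sH SH; exact: smallest_sub. Qed.

Lemma generatedS A B : A `<=` B -> generated A `<=` generated B.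
Proof.
move=> AB; apply: generated_sub (subgroup_generated B) _ => x /AB.
exact: sub_generated.
Qed.

Lemma generated_normalized S H :
    subgroup H -> (forall s x, S s -> H x -> S (s ^ x)) ->
  forall s x, generated S s -> H x -> generated S (s ^ x).
Proof.
move=> sH SH s x Ss Hx.
have : subgroup [set y | generated S (y ^ x)].
  apply/subgroupP; split=> [|a b /= Ga Gb].
    by rewrite /= conj1g; exact: subgroup1 (subgroup_generated _).
  rewrite conjMg conjVg; apply: (subgroupM (@subgroup_generated _)) => //.
  exact: (subgroupV (@subgroup_generated _)).
move/generated_sub; apply; [|exact: Ss].
by move=> t St /=; apply: sub_generated; exact: SH.
Qed.

(** A word uses finitely many letters: the elements reached with some finite part of [B] already
    form a subgroup. This later cuts the infinite set of double swaps down to a list. *)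
Lemma generated_finite A B x : generated (A `|` B) x ->
  exists2 l : seq gT, [set` l] `<=` B & generated (A `|` [set` l]) x.
Proof.
set P := [set x | exists2 l : seq gT, [set` l] `<=` B & generated (A `|` [set` l]) x].
suff /generated_sub : subgroup P.
  move=> + ABx; move/(_ _ _ _ ABx); apply=> y [Ay|By].
    by exists [::] => //; apply: sub_generated; left.
  exists [:: y]; last by apply: sub_generated; right; rewrite /= inE.
  by move=> z /=; rewrite inE => /eqP ->.
apply/subgroupP; split=> [|a b [la laB Ga] [lb lbB Gb]].
  by exists [::] => //; exact: subgroup1 (subgroup_generated _).
exists (la ++ lb) => [z /=|].
  by rewrite mem_cat => /orP[/laB|/lbB].
have sG := @subgroup_generated (A `|` [set` la ++ lb]).
apply: (subgroupM sG); last apply: (subgroupV sG).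
  apply: generatedS Ga => z [|/= z_la]; [by left|right=> /=].
  by rewrite mem_cat z_la.
apply: generatedS Gb => z [|/= z_lb]; [by left|right=> /=].
by rewrite mem_cat z_lb orbT.
Qed.

Lemma generated_finites A B (s : seq gT) : [set` s] `<=` generated (A `|` B) ->
  exists2 l : seq gT, [set` l] `<=` B & [set` s] `<=` generated (A `|` [set` l]).
Proof.
elim: s => [|x s IH] xsG; first by exists [::].
have [] := IH; first by move=> y ys; apply: xsG => /=; rewrite inE; apply/orP; right.
move=> l lB sl.
have [|l' lB' xl'] := @generated_finite A B x; first by apply: xsG; rewrite /= inE eqxx.
exists (l ++ l') => [z /=|z /=].
  by rewrite mem_cat => /orP[/lB|/lB'].
rewrite inE => /orP[/eqP ->|/sl]; [move: xl'|]; apply: generatedS => y [|/= yl].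
- by left.
- by right; rewrite /= mem_cat yl orbT.
- by left.
- by right; rewrite /= mem_cat yl.
Qed.

Lemma commMgR x y z : [~ x * y, z] = [~ x, z] ^ y * [~ y, z].
Proof. by rewrite !(commgEl, conjgE) !invgM !mulgA mulgK mulgK. Qed.

Lemma commVgR x z : [~ x^-1, z] = [~ x, z]^-1 ^ x^-1.
Proof. by rewrite !(commgEl, conjgE) !invgM !invgK !mulgA mulgK. Qed.

(** The group generated by [S] normalizes [N], and its generators commute modulo [N]. *)
Lemma generated_comm_sub S N : subgroup N -> (forall s, S s -> S s^-1) ->
    (forall s x, S s -> N x -> N (x ^ s)) ->
    (forall s t, S s -> S t -> N [~ s, t]) ->
  forall x y, generated S x -> generated S y -> N [~ x, y].
Proof.
move=> sN SV NS NR.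
have norm : generated S `<=` [set x | forall z, (N z <-> N (z ^ x))].
  apply: generated_sub.
    apply/subgroupP; split=> [z /=|a b /= Na Nb z]; first by rewrite conjg1.
    by rewrite conjgM (Na z) (Nb ((z ^ a) ^ b^-1)) conjgKV.
  move=> s Ss z; split=> [|Nzs]; first exact: NS.
  by rewrite -(conjgK s z); apply: NS => //; exact: SV.
(* One argument at a time passes from generators to words; inverting a commutator exchanges the two
   arguments. *)
have half t : (forall s, S s -> N [~ s, t]) -> generated S `<=` [set x | N [~ x, t]].
  move=> Nt x Sx.
  suff : (generated S `&` [set x | N [~ x, t]]) x by case.
  move: x Sx; apply: generated_sub.
    apply/subgroupP; split.
      split; first exact: subgroup1 (subgroup_generated _).
      by rewrite /= comm1g; exact: subgroup1.
    move=> a b [Sa Na] [Sb Nb]; split.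
      apply: (subgroupM (@subgroup_generated _)) => //.
      exact: (subgroupV (@subgroup_generated _)).
    have SbV : generated S b^-1 by exact: (subgroupV (@subgroup_generated _)).
    rewrite /= commMgR commVgR; apply: subgroupM => //.
      exact: (norm _ SbV _).1.
    by apply: (norm _ SbV _).1; exact: subgroupV.
  by move=> s Ss; split; [exact: sub_generated|exact: Nt].
move=> x y Sx Sy; apply: (half y _ x Sx) => s Ss.
rewrite -invgR; apply: subgroupV => //.
by apply: (half s _ y Sy) => t St; exact: NR.
Qed.

(** The factors [d] and [e] commute with everything in sight and cancel. In the applications they
    are extra motions supported away from [s], [t] and each other. *)
Lemma commg_mul_commute s t d e : commute d s -> commute d t -> commute d e ->
  commute e s -> commute e t -> [~ s * d, t * e] = [~ s, t].
Proof.
move=> ds dt de es et.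
have cR z : commute z s -> commute z t -> commute z [~ s, t].
  move=> zs zt; rewrite commgEl conjgE.
  have zsV := commuteV zs; have ztV := commuteV zt.
  by apply: (commuteM zsV); apply: (commuteM ztV); exact: commuteM.
apply: (@mulgI _ (t * e * (s * d))); rewrite -commgC.
have -> : t * e * (s * d) = t * s * (e * d) by rewrite -mulgA (mulgA e) es !mulgA.
have -> : s * d * (t * e) = s * t * (e * d) by rewrite -mulgA (mulgA d) dt -mulgA de !mulgA.
have edR : commute (e * d) [~ s, t].
  by apply/commute_sym/commuteM; apply/commute_sym; exact: cR.
by rewrite -[RHS]mulgA edR [RHS]mulgA -commgC.
Qed.
End Subgroups.

(** * Supports of homeomorphisms *)

Section Support.
Variable T : topologicalType.
Implicit Types (f g h : homeo T) (A B D : set T).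

Lemma homeo_inj f : injective f. Proof. exact: can_inj (@homeo_funK _ f). Qed.

Lemma homeo_imageE f A : f @` A = f^-1%g @^-1` A.
Proof.
apply/seteqP; split=> [_ [x Ax <-] /=|x /= Ax]; first by rewrite homeo_funK.
by exists (homeo_inv f x); rewrite ?homeo_invK.
Qed.

Lemma clopen_homeo f A : clopen A -> clopen (f @` A).
Proof.
by rewrite homeo_imageE => cA; apply: preimage_clopen => //; exact: homeo_continuous.
Qed.

Lemma homeo_imageM f g A : (f * g) @` A = g @` (f @` A).
Proof. by rewrite !homeo_imageE. Qed.

Definition supp_in A f := forall x, ~ A x -> f x = x.

Lemma supp_inM A f g : supp_in A f -> supp_in A g -> supp_in A (f * g).
Proof. by move=> Af Ag x Ax; rewrite /= Af // Ag. Qed.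

Lemma supp_inV A f : supp_in A f -> supp_in A f^-1.
Proof. by move=> Af x Ax; apply: (@homeo_inj f); rewrite /= homeo_invK Af. Qed.

Lemma supp_inX A f n : supp_in A f -> supp_in A (f ^+ n).
Proof. by move=> Af; elim: n => // n IH; rewrite expgS; exact: supp_inM. Qed.

Lemma supp_inS A B f : A `<=` B -> supp_in A f -> supp_in B f.
Proof. by move=> AB Af x Bx; apply: Af => /AB. Qed.

Lemma supp_inJ A f g : supp_in A f -> supp_in (g @` A) (f ^ g).
Proof.
move=> Af x; rewrite homeo_imageE => Ax.
by rewrite /= Af // homeo_invK.
Qed.

Lemma supp_in_mem A B f x : supp_in A f -> A `<=` B -> B (f x) <-> B x.
Proof.
move=> Af AB; have [Ax|Ax] := pselect (A x); last by rewrite Af.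
split=> _; apply: AB => //; apply: contrapT => Afx.
by apply: (Afx); rewrite (homeo_inj (Af _ Afx)).
Qed.

Lemma supp_in_commute A B f g : (forall x, A x -> B x -> False) ->
  supp_in A f -> supp_in B g -> commute f g.
Proof.
move=> AB Af Bg; apply: homeo_ext => x /=.
have [Ax|Ax] := pselect (A x).
  rewrite (Bg x); last exact: AB.
  by apply: Bg; apply: AB; apply/(supp_in_mem _ Af).
rewrite (Af x Ax) Af // => Agx; apply: Ax.
suff gx : g x = x by rewrite -gx.
by apply: (Bg) => /(supp_in_mem x Bg (@subset_refl _ B)); exact: AB.
Qed.

Lemma subgroup_supp_in A : subgroup (supp_in A).
Proof.
apply/subgroupP; split=> // x y Ax Ay.
by apply: supp_inM => //; exact: supp_inV.
Qed.

End Support.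

(** * Induction over clopen sets of a compact space *)

Section Compactness.
Variable T : ptopologicalType.
Hypothesis compactT : compact [set: T].

(** Finitely many of the neighbourhoods with [P] cover the space, so [P] holds for the whole space
    and descends to [A]. *)
Lemma clopen_ind (P : set T -> Prop) :
    (forall A B, A `<=` B -> clopen A -> clopen B -> P B -> P A) ->
    (forall A B, clopen A -> clopen B -> P A -> P B -> P (A `|` B)) ->
    (forall x, exists A, [/\ clopen A, A x & P A]) ->
  forall A, clopen A -> P A.
Proof.
move=> PS PU Px A cA; apply: (PS _ _ (@subsetT _ A) cA clopenT).
have [f fP] := choice Px.
move: compactT; rewrite compact_cover => /(_ T setT f).
case=> [x _|x _|D _ DT]; first by have [[]] := fP x.
  by exists x => //; have [] := fP x.
suff [cD PD] : clopen (\bigcup_(i in [set` D]) f i) /\ P (\bigcup_(i in [set` D]) f i).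
  by apply: (PS _ _ _ _ _ PD) => //; exact: clopenT.
have {DT}: {subset (enum_fset D) <= [set: T]} by move=> x _; exact/in_setT.
rewrite (_ : [set` D] = [set` enum_fset D]) //.
elim: (enum_fset D) => [_|x s IH _].
  (* The empty union inherits [P] from the neighbourhood of the base point. *)
  rewrite (_ : \bigcup_(_ in _) _ = set0); last by rewrite -subset0 => y [].
  have [c0 _ P0] := fP point; split; first exact: clopen0.
  by apply: (PS _ _ _ _ _ P0) => //; exact: clopen0.
have [|cs Ps] := IH; first by move=> *; exact/in_setT.
have -> : \bigcup_(i in [set` x :: s]) f i = f x `|` \bigcup_(i in [set` s]) f i.
  apply/seteqP; split=> [y [z /=]|y [fy|[z /= zs fz]]].
  - by rewrite inE => /predU1P[->|zs] fz; [left|right; exists z].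
  - by exists x; rewrite //= mem_head.
  - by exists z; rewrite //= inE zs orbT.
have [cx _ Pfx] := fP x.
by split; [exact: clopenU|exact: PU].
Qed.

End Compactness.

(** * Permuting disjoint copies of a clopen set *)

Lemma clopen_exists (T : topologicalType) n (F : 'I_n -> set T) :
  (forall i, clopen (F i)) -> clopen [set x | exists i, F i x].
Proof.
move=> cF.
have -> : [set x | exists i, F i x] = \big[setU/set0]_(i <- enum 'I_n) F i.
  apply/seteqP; split=> x /=; rewrite -bigcup_seq.
    by case=> i Fix; exists i => //=; rewrite mem_enum.
  by case=> i _ Fix; exists i.
by elim/big_ind: _ => // *; [exact: clopen0|exact: clopenU].
Qed.

Lemma continuous_locally_homeo (T : topologicalType) (f : T -> T) :
  (forall x, exists A (h : homeo T), [/\ clopen A, A x & forall y, A y -> f y = h y]) ->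
  continuous f.
Proof.
move=> fh x; have [A [h [[oA _] Ax hE]]] := fh x.
have hx : h y @[y --> x] --> f x by rewrite hE //; exact: homeo_continuous.
apply: cvg_trans hx; apply: near_eq_cvg.
have : nbhs x A by exact: open_nbhs_nbhs.
by apply: filterS => y /hE.
Qed.

Section PiecePermutations.
Variables (T : topologicalType) (n : nat).
Implicit Types (A : set T) (gam : 'I_n -> homeo T) (pi : 'S_n).

Definition pieces A gam := [set x | exists i, (gam i @` A) x].

Definition disjoint_pieces A gam :=
  forall i j x y, A x -> A y -> gam i x = gam j y -> i = j.

Lemma clopen_pieces A gam : clopen A -> clopen (pieces A gam).
Proof. by move=> cA; apply: clopen_exists => i; exact: clopen_homeo. Qed.

(** The index picked by [cid] is determined by [x] as soon as the pieces are disjoint. *)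
Definition perm_pieces_fun A gam pi x :=
  if pselect (exists i, (gam i @` A) x) is left e
  then let i := projT1 (cid e) in gam (pi i) (homeo_inv (gam i) x) else x.

Section Permute.
Variables (A : set T) (gam : 'I_n -> homeo T).
Hypotheses (cA : clopen A) (dA : disjoint_pieces A gam).

Lemma perm_pieces_funE pi i x : A x -> perm_pieces_fun A gam pi (gam i x) = gam (pi i) x.
Proof.
move=> Ax; rewrite /perm_pieces_fun; case: pselect => [e|]; last first.
  by case; exists i; exists x.
case: (cid e) => j /= [y Ay yx].
by have ij : i = j := esym (dA Ay Ax yx); rewrite -ij homeo_funK.
Qed.

Lemma perm_pieces_fun_out pi x : ~ pieces A gam x -> perm_pieces_fun A gam pi x = x.
Proof. by rewrite /perm_pieces_fun; case: pselect. Qed.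

Lemma perm_pieces_funK pi :
  cancel (perm_pieces_fun A gam pi) (perm_pieces_fun A gam pi^-1).
Proof.
move=> x; have [[i [y Ay <-]]|nx] := pselect (pieces A gam x).
  by rewrite !perm_pieces_funE // permK.
by rewrite !perm_pieces_fun_out.
Qed.

(** The explicit form of [h] serves twice: for continuity here, and later to place piece
    permutations in the topological full group. *)
Lemma perm_pieces_fun_local pi x : exists B (h : homeo T),
  [/\ clopen B, B x, h = 1 \/ (exists i j, h = (gam i)^-1 * gam j) &
      forall y, B y -> perm_pieces_fun A gam pi y = h y].
Proof.
have [[i ix]|nx] := pselect (pieces A gam x).
  exists (gam i @` A), ((gam i)^-1 * gam (pi i)); split=> //.
  - exact: clopen_homeo.
  - by right; exists i, (pi i).
  - by move=> _ [y Ay <-]; rewrite perm_pieces_funE //= homeo_funK.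
exists (~` pieces A gam), 1; split=> //; last by move=> y; exact: perm_pieces_fun_out.
  by apply: (@clopenC _ _ set0); exact: clopen_pieces.
by left.
Qed.

Lemma perm_pieces_fun_continuous pi : continuous (perm_pieces_fun A gam pi).
Proof.
apply: continuous_locally_homeo => x.
by have [B [h [? ? _ ?]]] := perm_pieces_fun_local pi x; exists B, h.
Qed.

Lemma perm_pieces_funVK pi :
  cancel (perm_pieces_fun A gam pi^-1) (perm_pieces_fun A gam pi).
Proof. by move=> x; rewrite -[in RHS](perm_pieces_funK pi^-1 x) invgK. Qed.

Definition perm_pieces pi := Homeo (perm_pieces_funK pi) (perm_pieces_funVK pi)
  (@perm_pieces_fun_continuous pi) (@perm_pieces_fun_continuous pi^-1).

Lemma perm_piecesE pi i x : A x -> perm_pieces pi (gam i x) = gam (pi i) x.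
Proof. exact: perm_pieces_funE. Qed.

Lemma supp_in_perm_pieces pi : supp_in (pieces A gam) (perm_pieces pi).
Proof. by move=> x; exact: perm_pieces_fun_out. Qed.

Lemma perm_pieces_uniq pi h : supp_in (pieces A gam) h ->
  (forall i x, A x -> h (gam i x) = gam (pi i) x) -> perm_pieces pi = h.
Proof.
move=> hA hE; apply: homeo_ext => x.
have [[i [y Ay <-]]|nx] := pselect (pieces A gam x).
  by rewrite perm_piecesE // hE.
by rewrite hA // (supp_in_perm_pieces pi).
Qed.

Lemma perm_piecesM : {morph perm_pieces : s t / s * t}.
Proof.
move=> s t; apply: perm_pieces_uniq => [|i x Ax].
  by apply: supp_inM; exact: supp_in_perm_pieces.
by rewrite [LHS]/= !perm_pieces_funE // permM.
Qed.

Lemma perm_pieces1 : perm_pieces 1 = 1.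
Proof. by apply: perm_pieces_uniq => // i x _; rewrite perm1. Qed.

Lemma perm_piecesV s : perm_pieces s^-1 = (perm_pieces s)^-1.
Proof.
by apply: (@mulgI _ (perm_pieces s)); rewrite -perm_piecesM !mulgV perm_pieces1.
Qed.

Lemma perm_piecesX s k : perm_pieces (s ^+ k) = perm_pieces s ^+ k.
Proof. by elim: k => [|k IH]; rewrite ?perm_pieces1 // !expgS perm_piecesM IH. Qed.

Lemma perm_piecesR s t : perm_pieces [~ s, t] = [~ perm_pieces s, perm_pieces t].
Proof. by rewrite !commgEl !conjgE !perm_piecesM !perm_piecesV. Qed.

Lemma disjoint_pieces_perm (s : 'S_n) : disjoint_pieces A (gam \o s).
Proof. by move=> i j x y Ax Ay /(dA Ax Ay); exact: perm_inj. Qed.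

Lemma pieces_perm (s : 'S_n) : pieces A (gam \o s) = pieces A gam.
Proof.
apply/seteqP; split=> x [i ix]; first by exists (s i).
by exists (s^-1 i); rewrite /= permKV.
Qed.

Lemma disjoint_pieces_mul h : disjoint_pieces A (fun i => gam i * h).
Proof. by move=> i j x y Ax Ay /(@homeo_inj _ h); exact: dA. Qed.

Lemma pieces_mul (h : homeo T) : pieces A (fun i => gam i * h) = h @` pieces A gam.
Proof.
apply/seteqP; split=> [_ [i [x Ax <-]]|_ [_ [i [x Ax <-]] <-]].
  by exists (gam i x) => //; exists i; exists x.
by exists i; exists x.
Qed.

End Permute.

Arguments disjoint_pieces_perm [A gam] dA s.
Arguments disjoint_pieces_mul [A gam] dA h.

(** Relabelling turns into conjugation, so swaps given by different labellings of the same pieces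
    are computed in one symmetric group. *)
Lemma perm_pieces_reindex A gam (cA : clopen A) (dA : disjoint_pieces A gam) (s pi : 'S_n) :
  perm_pieces cA (disjoint_pieces_perm dA s) pi = perm_pieces cA dA (pi ^ s).
Proof.
apply/esym/perm_pieces_uniq => [|i x Ax].
  by rewrite -(pieces_perm A gam s); exact: supp_in_perm_pieces.
rewrite -[in LHS](permKV s i).
have -> : gam (s (s^-1 i)) x = (gam \o s) (s^-1 i) x by [].
by rewrite perm_piecesE //= conjgE !permM.
Qed.

Lemma perm_piecesJ A gam (cA : clopen A) (dA : disjoint_pieces A gam) (h : homeo T) pi :
  perm_pieces cA dA pi ^ h = perm_pieces cA (disjoint_pieces_mul dA h) pi.
Proof.
apply/esym/perm_pieces_uniq => [|i x Ax].
  by rewrite pieces_mul; apply: supp_inJ; exact: supp_in_perm_pieces.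
by rewrite /= homeo_funK perm_pieces_funE.
Qed.

End PiecePermutations.

Arguments disjoint_pieces_perm {T n A gam} dA s.
Arguments disjoint_pieces_mul {T n A gam} dA h.

(* With n = 4 t^2 + 1, the reflection x |-> - x of Z/n is the square of
   multiplication by 2 t, hence even. *)
Lemma rotation_even_reflections t (n := (4 * t ^ 2)%N) : exists r r' : 'S_n.+1,
  [/\ odd_perm r = false, odd_perm r' = false, r ^+ 2 = 1, r' ^+ 2 = 1 &
      forall k i, val (((r * r') ^+ k) i) = (i + k) %% n.+1].
Proof.
(* In Z/(n+1) the number [n], which is the square of [2 * t], equals -1. *)
have char (i : 'I_n.+1) : (i *+ n = - i)%R.
  apply/eqP; rewrite -GRing.addr_eq0 -GRing.mulrSr; apply/eqP/val_inj.
  by rewrite Zp_mulrn /= modnMl.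
have char2 (i : 'I_n.+1) : (i *+ (2 * t) *+ (2 * t) = - i)%R.
  by rewrite -GRing.mulrnA -char; congr (_ *+ _)%R; rewrite /n; lia.
have uinj : injective (fun i : 'I_n.+1 => i *+ (2 * t))%R.
  by move=> i j /(congr1 (fun x : 'I_n.+1 => x *+ (2 * t))%R) /=; rewrite !char2 => /GRing.oppr_inj.
(* [h] is one half of 1. Conjugating [r] by translation by [h] gives the reflection sending [x] to
   [1 - x], so the product of the two reflections is translation by 1. *)
pose h : 'I_n.+1 := inZp (2 * t ^ 2).+1.
have hh : (h + h = inZp 1)%R.
  apply: val_inj => /=; rewrite modnDm (_ : _ + _ = n.+1 + 1)%N ?modnDl //.
  by rewrite /n; lia.
pose r : 'S_n.+1 := perm (@GRing.oppr_inj 'I_n.+1).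
pose u : 'S_n.+1 := perm uinj.
pose s : 'S_n.+1 := perm (@GRing.addIr 'I_n.+1 h).
have ru : r = u * u by apply/perm.permP => i; rewrite permM !permE char2.
have r2 : r ^+ 2 = 1 by apply/perm.permP => i; rewrite permM !permE GRing.opprK.
exists r, (r ^ s); split=> //.
- by rewrite ru odd_permM addbb.
- by rewrite odd_permJ ru odd_permM addbb.
- by rewrite -conjXg r2 conj1g.
have wE i : (r * r ^ s) i = (i + inZp 1)%R.
  rewrite permM (_ : r i = s (- i - h)%R); last by rewrite !permE GRing.subrK.
  by rewrite permJ !permE GRing.opprB GRing.opprK GRing.addrAC GRing.addrC hh.
elim=> [|k IH] i; first by rewrite perm1 addn0 modn_small.
by rewrite expgSr permM wE /= IH modnDm addn1 addnS.
Qed.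

(** * Spreading involutions over translates *)

(** A smaller exponent gives a power at most half as large; after comparing the exponents pairwise,
    linear arithmetic excludes everything but [l = i]. *)
Lemma pow2_sidon i j l m : i != j -> (2 ^ l + 2 ^ j = 2 ^ m + 2 ^ i -> l = i)%N.
Proof.
have dbl a b : (a < b -> 2 * 2 ^ a <= 2 ^ b)%N.
  by move=> ab; rewrite -expnS leq_exp2l.
have pos a : (0 < 2 ^ a)%N by rewrite expn_gt0.
move: (pos i) (pos j) (pos l) (pos m) => pi pj pl pm ij e.
case: (ltngtP l i) => // li; case: (ltngtP j i) ij => // ji _;
case: (ltngtP m j) => mj; case: (ltngtP m l) => ml; rewrite ?(mj, ml) in e *;
repeat match goal with H : is_true (_ < _)%N |- _ => move: (dbl _ _ H); clear H end; lia.
Qed.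

Section Spread.
Variables (T : topologicalType) (U : set T) (w : homeo T) (n : nat) (s : nat -> homeo T).
Hypothesis sU : forall i, i < n -> supp_in U (s i).
Hypothesis s2 : forall i, i < n -> s i ^+ 2 = 1.
Hypothesis wU : forall k, 0 < k < 2 ^ n -> forall x, U x -> ~ U ((w ^+ k) x).

Lemma translates_disjoint a b x y : a != b -> 0 < a <= 2 ^ n -> 0 < b <= 2 ^ n ->
  U x -> U y -> (w ^+ a) x <> (w ^+ b) y.
Proof.
wlog ab : a b x y / a < b => [hw|_].
  move=> nab an bn Ux Uy; case: (ltngtP a b) => // [ab|ba|ab]; first exact: hw.
    by move=> /esym; apply: hw => //; rewrite ltn_eqF.
  by rewrite ab eqxx in nab.
move=> an bn Ux Uy; have /wU/(_ _ Uy) nU : 0 < b - a < 2 ^ n by lia.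
rewrite -(subnK (ltnW ab)) expgnDr => /(@homeo_inj _ (w ^+ a) x ((w ^+ (b - a)) y)) xE.
by apply: nU; rewrite -xE.
Qed.

Let blocks m := [set x | exists l, l < m /\ ((w ^+ (2 ^ l)%N) @` U) x].

Let others m i := [set x | exists l, [/\ l < m, l != i & ((w ^+ (2 ^ l)%N) @` U) x]].

(** The clause over all [H] records that [c] is a word in [w] and the [s i]; it is later applied to
    [G] and to groups of elements with restricted support. *)
Lemma spread_exists m : m <= n -> exists c, [/\ c ^+ 2 = 1, supp_in (blocks m) c,
  (forall H, subgroup H -> H w -> (forall i, i < m -> H (s i)) -> H c) &
  forall i, i < m -> exists2 d, supp_in (others m i) d & c = s i ^ (w ^+ (2 ^ i)%N) * d].
Proof.
elim: m => [|m IH] mn; first by exists 1; split=> // [|H /subgroup1//]; exact: mulg1.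
have [c [c2 suppc cH cE]] := IH (ltnW mn).
have pow_bound k : k <= m -> 0 < 2 ^ k <= 2 ^ n.
  by move=> km; rewrite expn_gt0 leq_exp2l // (leq_trans km) // ltnW.
have supps : supp_in ((w ^+ (2 ^ m)%N) @` U) (s m ^ (w ^+ (2 ^ m)%N)).
  by apply: supp_inJ; exact: sU.
have cs : commute c (s m ^ (w ^+ (2 ^ m)%N)).
  apply: supp_in_commute suppc supps => _ [l [lm [x Ux <-]]] [y Uy].
  apply: translates_disjoint => //; first by rewrite eqn_exp2l // gtn_eqF.
    exact: pow_bound.
  by apply: pow_bound; exact: ltnW.
exists (c * s m ^ (w ^+ (2 ^ m)%N)); split.
- by rewrite expgMn // c2 -conjXg s2 // conj1g mulg1.
- apply: supp_inM; [apply: supp_inS suppc|apply: supp_inS supps] => x.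
    by move=> [l [lm ?]]; exists l; split=> //; exact: ltnW.
  by exists m.
- move=> H sH Hw Hs; apply: (subgroupM sH).
    by apply: cH => // i im; apply: Hs; exact: ltnW.
  by apply: (subgroupJ sH); [exact: Hs|exact: subgroupX].
- move=> i; rewrite ltnS leq_eqVlt => /predU1P[->|im].
    exists c; last by rewrite cs.
    apply: supp_inS suppc => x [l [lm ?]]; exists l; split=> //; first exact: ltnW.
    by rewrite ltn_eqF.
  have [d suppd cd] := cE i im; exists (d * s m ^ (w ^+ (2 ^ m)%N)).
    apply: supp_inM; [apply: supp_inS suppd|apply: supp_inS supps] => x.
      by move=> [l [lm ? ?]]; exists l; split=> //; exact: ltnW.
    by exists m; split=> //; rewrite gtn_eqF.
  by rewrite cd -mulgA.
Qed.

(* The conjugate of [c] by [w ^- (2 ^ i)] acts on [U] as [s i], and off [U] these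
   conjugates have disjoint supports because powers of 2 form a Sidon set. *)
Lemma spread_involution : exists c, [/\ c ^+ 2 = 1,
  (forall H, subgroup H -> H w -> (forall i, i < n -> H (s i)) -> H c),
  (forall K, subgroup K -> K w -> K c -> forall x y,
     generated [set s i | i in [set i | i < n]] x ->
     generated [set s i | i in [set i | i < n]] y -> K [~ x, y]) &
  forall i, i < n -> s i <> 1 -> c <> 1].
Proof.
have [c [c2 suppc cH cE]] := spread_exists (leqnn n).
(* [V i] is the union of the other blocks pulled back by [w ^+ (2 ^ i)]. *)
pose V i := [set x | exists l u, [/\ l < n, l != i, U u & (w ^+ (2 ^ i)%N) x = (w ^+ (2 ^ l)%N) u]].
have cD i : i < n -> exists2 d, supp_in (V i) d & c ^ (w ^- (2 ^ i)%N) = s i * d.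
  move=> /cE[d suppd ->]; exists (d ^ (w ^- (2 ^ i)%N)); last by rewrite conjMg conjgK.
  apply: supp_inS (supp_inJ suppd) => _ [_ [l [ln li [u Uu <-]]] <-].
  by exists l, u; split=> //; exact: homeo_invK.
have pow_bound k : k < n -> 0 < 2 ^ k <= 2 ^ n.
  by move=> /ltnW km; rewrite expn_gt0 leq_exp2l.
(* Sums of two exponents still lie between 1 and [2 ^ n], the range in which the translates of [U]
   are known to be disjoint. *)
have pow_bound2 k l : k < n -> l < n -> 0 < 2 ^ k + 2 ^ l <= 2 ^ n.
  move=> kn ln; have n0 : 0 < n by exact: leq_ltn_trans kn.
  rewrite addn_gt0 expn_gt0 /= -(prednK n0) expnS mul2n -addnn.
  by apply: leq_add; rewrite leq_exp2l // -ltnS prednK.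
have UV i x : i < n -> U x -> V i x -> False.
  move=> ni Ux [l [u [ln li Uu]]].
  by apply: translates_disjoint => //; rewrite ?pow_bound // eqn_exp2l // eq_sym.
(* Applying both powers of [w] to a common point puts it in the translates with exponents
   [2 ^ l + 2 ^ j] and [2 ^ m + 2 ^ i]. These must coincide, and the Sidon property gives the
   excluded [l = i]. *)
have VV i j x : i < n -> j < n -> i != j -> V i x -> V j x -> False.
  move=> ni nj ij [l [u [ln li Uu xu]]] [m [v [mn mj Uv xv]]].
  have : (w ^+ (2 ^ l + 2 ^ j)%N) u = (w ^+ (2 ^ m + 2 ^ i)%N) v.
    rewrite !expgnDr.
    have -> : (w ^+ (2 ^ l)%N * w ^+ (2 ^ j)%N) u = (w ^+ (2 ^ i)%N * w ^+ (2 ^ j)%N) x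
      by rewrite /= xu.
    have -> : w ^+ (2 ^ i)%N * w ^+ (2 ^ j)%N = w ^+ (2 ^ j)%N * w ^+ (2 ^ i)%N.
      by rewrite -!expgnDr addnC.
    by rewrite /= xv.
  apply: translates_disjoint => //; rewrite ?pow_bound2 //.
  by apply: contra_neq li => /(pow2_sidon ij).
exists c; split=> // [K sK Kw Kc|i ni si c1]; last first.
  (* If [c] were trivial, [s i] would be the inverse of [d], which fixes [U] pointwise; but [s i]
     moves points of [U] only. *)
  have [d suppd] := cD i ni; rewrite c1 conj1g => /esym/(congr1 (mul (s i)^-1)).
  rewrite mulKg mulg1 => dE; apply: si; apply: homeo_ext => x.
  have [Ux|Ux] := pselect (U x); last by rewrite sU.
  have dx : d x = x by apply: suppd => /(UV i x ni Ux).
  by rewrite -[in LHS]dx dE /= homeo_invK.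
(* On elements supported in [U], conjugation by [s i] agrees with conjugation by a conjugate of [c]
   in [K], because the remaining factor [d] is supported off [U]. *)
have sN : subgroup (K `&` supp_in U).
  apply/subgroupP; split; first by split; [exact: subgroup1|].
  move=> a b [Ka Ua] [Kb Ub]; split; first by apply: subgroupM => //; exact: subgroupV.
  by apply: supp_inM => //; exact: supp_inV.
move=> x y Sx Sy.
suff : (K `&` supp_in U) [~ x, y] by case.
have Kz i : K (w ^- (2 ^ i)%N) by apply: subgroupV => //; exact: subgroupX.
apply: (generated_comm_sub sN _ _ _ Sx Sy).
- move=> _ [i /= ni <-]; exists i => //=.
  by apply/esym/(@mulg1_eq _ (s i)); exact: s2.
- move=> _ a [i /= ni <-] [Ka Ua].
  have Uas : supp_in U (a ^ s i).
    apply: (subgroupJ (@subgroup_supp_in _ U)) => //; exact: sU.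
  split=> //; have [d suppd cd] := cD i ni.
  suff -> : a ^ s i = a ^ (c ^ w ^- (2 ^ i)%N).
    by apply: subgroupJ => //; exact: subgroupJ.
  rewrite cd conjgM; apply/esym/conjg_fixP/commgP.
  by apply: supp_in_commute Uas suppd => z; exact: UV.
move=> _ _ [i /= ni <-] [j /= nj <-]; split; last first.
  by apply: (subgroupR (@subgroup_supp_in _ U)); exact: sU.
have [<-|ij] := eqVneq i j; first by rewrite commgg; exact: subgroup1.
have [d suppd cd] := cD i ni; have [e suppe ce] := cD j nj.
rewrite -(@commg_mul_commute _ (s i) (s j) d e) -?cd -?ce.
- by apply: subgroupR => //; exact: subgroupJ.
- by apply/commute_sym; apply: supp_in_commute (sU ni) suppd => z; exact: UV.
- by apply/commute_sym; apply: supp_in_commute (sU nj) suppd => z; exact: UV.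
- by apply: supp_in_commute suppd suppe => z; exact: VV.
- by apply/commute_sym; apply: supp_in_commute (sU ni) suppe => z; exact: UV.
- by apply/commute_sym; apply: supp_in_commute (sU nj) suppe => z; exact: UV.
Qed.

End Spread.

(** * Vigorous simple groups *)

Lemma properI_ex (T : Type) (A B : set T) :
  A `<` B <-> A `<=` B /\ exists2 x, B x & ~ A x.
Proof.
split=> [[AB BA]|[AB [x Bx Ax]]]; split=> //; last by move/(_ x Bx).
by apply: contrapT => nB; apply: BA => x Bx; apply: contrapT => Ax; apply: nB; exists x.
Qed.

Lemma clopenD (T : topologicalType) (A B : set T) :
  clopen A -> clopen B -> clopen (A `\` B).
Proof. by move=> cA cB; apply: clopenI => //; exact: clopenC. Qed.

Section Vigorous.
Variable T : ptopologicalType.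
Hypothesis compactT : compact [set: T].
Hypothesis splitT : forall O : set T, clopen O -> O !=set0 ->
  exists V, [/\ clopen V, V `<=` O, V !=set0 & (O `\` V) !=set0].
Variable G : set (homeo T).
Hypothesis subgroupG : subgroup G.
Hypothesis simpleG : simple_group G.
Hypothesis vigorousG : vigorous G.
Implicit Types (f g h k : homeo T) (A B C D O X Y : set T).

(** * Extending local behaviour to elements of [G] with prescribed support *)

Lemma clopen_avoid O x : clopen O -> O !=set0 ->
  exists O', [/\ clopen O', O' `<=` O, O' !=set0 & ~ O' x].
Proof.
move=> cO nO; have [V [cV VO nV nOV]] := splitT cO nO.
have [Vx|Vx] := pselect (V x); last by exists V.
by exists (O `\` V); split=> // [|[]//]; exact: clopenD.
Qed.

(** Vigour, completed by the cases [B] empty and [C = A], in which the identity works. *)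
Lemma vigorous_move A B C : clopen A -> clopen B -> clopen C -> B `<` A ->
    C `<=` A -> C !=set0 ->
  exists g, [/\ G g, supp_in A g & forall x, B x -> C (g x)].
Proof.
move=> cA cB cC BA CA nC.
have [nB|/nonemptyPn B0] := pselect (B !=set0); last first.
  by exists 1; split=> // [|x]; [exact: subgroup1|by rewrite B0 => -[]].
have [AC|nAC] := pselect (A `<=` C).
  by exists 1; split=> // [|x]; [exact: subgroup1|by move=> /(BA.1 _)/AC].
have [g [Gg gBC gA]] := vigorousG cA cB cC BA nB (conj CA nAC) nC.
by exists g; split=> // x Bx; apply: gBC; exists x.
Qed.

(** Quantifying over [A'] makes the property pass to subsets of [A]; the proper inclusion leaves
    room in [D] for the extra support that an extension costs. *)
Definition movable A h := forall A' D, A' `<=` A -> clopen A' -> clopen D ->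
  A' `|` h @` A' `<` D ->
  exists g, [/\ G g, supp_in D g & forall x, A' x -> g x = h x].

(** Vigour gives [k] in [G] that fixes [W], the union of [A'] and its image, and pushes the rest of
    the support of [s] into [D]; then [s ^ k] works. The point [o] in [O] but not in [W] makes the
    pushed set proper in the complement of [W]. *)
Lemma movable_small_support s O A : G s -> clopen O -> supp_in (~` O) s ->
  clopen A -> (O `\` A) !=set0 -> movable A s.
Proof.
move=> Gs cO Os cA [o [Oo Ao]] A' D A'A cA' cD /properI_ex[AD [d Dd /not_orP[dA' dsA']]].
set W := A' `|` s @` A'.
have cW : clopen W by apply: clopenU => //; exact: clopen_homeo.
have Wo : ~ W o.
  move=> [/A'A//|]; rewrite homeo_imageE /= => A'so.
  have so : s o = o by apply: Os.
  by apply/Ao/A'A; rewrite -so homeo_funK in A'so.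
have [k [Gk Ek kD]] : exists k, [/\ G k, supp_in (~` W) k &
    forall x, (~` W `\` O) x -> (D `\` W) (k x)].
  apply: vigorous_move.
  - exact: clopenC.
  - by apply: clopenD => //; exact: clopenC.
  - exact: clopenD.
  - by apply/properI_ex; split=> [x []//|]; exists o => // -[].
  - by move=> x [].
  - by exists d; split=> // -[].
exists (s ^ k); split=> [||x A'x]; first exact: subgroupJ.
  move=> x Dx /=.
  have [Oy|Oy] := pselect (O (homeo_inv k x)).
    by rewrite (Os (homeo_inv k x)) ?homeo_invK.
  have [Wy|Wy] := pselect (W (homeo_inv k x)).
    have := Ek _ (fun nW => nW Wy); rewrite homeo_invK => xE.
    by case: Dx; apply: AD; rewrite xE.
  by have [] := kD (homeo_inv k x) (conj Wy Oy); rewrite homeo_invK.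
have -> /= : (s ^ k) x = k (s (k^-1 x)) by [].
have kx : homeo_inv k x = x.
  by apply: (supp_inV Ek) => /= nWx; apply: nWx; left.
by rewrite kx Ek //; apply; right; exists x.
Qed.

(** The set [D] may miss the intermediate image under [s]. So [s] and [t] are first realised with
    supports missing part of [O], and the small support of the product then lets it be squeezed into
    [D]. *)
Lemma movableM A s t : movable A s -> movable (s @` A) t ->
  forall O, clopen O -> O !=set0 -> O `<=` ~` (A `|` s @` A `|` t @` (s @` A)) ->
  clopen A -> movable A (s * t).
Proof.
move=> As At O cO nO OA cA A' D A'A cA' cD AD.
have [O1 [cO1 O1O nO1 [o [Oo O1o]]]] := splitT cO nO.
have csA' : clopen (s @` A') by exact: clopen_homeo.
have cstA' : clopen (t @` (s @` A')) by exact: clopen_homeo.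
have sA'A : s @` A' `<=` s @` A by exact: image_subset.
have stA'A : t @` (s @` A') `<=` t @` (s @` A) by exact: image_subset.
have [z O1z] := nO1.
have OA' x : O x -> [/\ ~ A' x, ~ (s @` A') x & ~ (t @` (s @` A')) x].
  move=> /OA nx; split=> [/A'A|/sA'A|/stA'A] Ax; apply: nx; [left; left|left; right|right] => //.
have [z1 z2 z3] := OA' _ (O1O _ O1z).
have [o1 o2 o3] := OA' _ Oo.
have [g [Gg supg gs]] : exists g, [/\ G g, supp_in (A' `|` s @` A' `|` O1) g &
    forall x, A' x -> g x = s x].
  apply: As => //; first by do !apply: clopenU => //.
  by apply/properI_ex; split; [move=> x; left|exists z; [right|case]].
have [h [Gh suph ht]] : exists h, [/\ G h, supp_in (s @` A' `|` t @` (s @` A') `|` O1) h &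
    forall x, (s @` A') x -> h x = t x].
  apply: At => //; first by do !apply: clopenU => //.
  by apply/properI_ex; split; [move=> x; left|exists z; [right|case]].
have ghst x : A' x -> (g * h) x = (s * t) x.
  by move=> A'x /=; rewrite gs // ht //; exists x.
set W := A' `|` s @` A' `|` t @` (s @` A') `|` O1.
have cW : clopen W by do !apply: clopenU => //.
have Wgh : supp_in (~` ~` W) (g * h).
  rewrite setCK; apply: supp_inM; [apply: supp_inS supg|apply: supp_inS suph] => x;
    rewrite /W; case=> [[]|]; do ?[by right|by left; left; left
                         |by left; left; right|by left; right].
have [||w [Gw Dw wgh]] := movable_small_support (subgroupM subgroupG Gg Gh) (@clopenC _ W W cW)
    Wgh cA' _ (@subset_refl _ _) cA' cD.
- exists o; split=> //; rewrite /W => -[[[]|]|] //.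
- rewrite (_ : (g * h) @` A' = (s * t) @` A') //.
  by apply/seteqP; split=> _ [x A'x <-]; exists x; rewrite ?ghst.
by exists w; split=> // x A'x; rewrite wgh // ghst.
Qed.

Lemma movableS A B s : A `<=` B -> movable B s -> movable A s.
Proof. by move=> AB Bs A' D A'A; apply: Bs; exact: subset_trans AB. Qed.

Lemma movableV A s : movable A s -> movable (s @` A) s^-1.
Proof.
move=> As A' D A'A cA' cD AD.
have sA'E : s @` (s^-1%g @` A') = A' by rewrite -homeo_imageM mulVg; exact: image_id.
have [] := As (s^-1%g @` A') D.
- move=> _ [x /A'A [y Ay <-] <-]; suff -> : s^-1 (s y) = y by [].
  exact: homeo_funK.
- exact: clopen_homeo.
- by [].
- by rewrite sA'E setUC.
move=> g [Gg Dg gs]; exists g^-1; split; [exact: subgroupV|exact: supp_inV|].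
move=> x A'x; apply: (@homeo_inj _ g); rewrite (gs (s^-1 x)) /= ?homeo_invK //.
by exists x.
Qed.

Lemma movableJ A s k : G k -> movable A s -> movable (k @` A) (s ^ k).
Proof.
move=> Gk As A' D A'A cA' cD AD.
have kE x : k^-1 (k x) = x by exact: homeo_funK.
have [] := As (k^-1%g @` A') (k^-1%g @` D).
- by move=> _ [x /A'A [y Ay <-] <-]; rewrite kE.
- exact: clopen_homeo.
- exact: clopen_homeo.
- move: AD => /properI_ex[AD [d Dd dA]]; apply/properI_ex; split=> [x|].
    rewrite !homeo_imageE /= => -[A'x|A'x]; apply: AD; [by left|right].
    by rewrite homeo_imageE /= homeo_funK.
  exists (k^-1 d); first by exists d.
  apply: contra_not dA; rewrite !homeo_imageE /= => -[]; last by right.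
  by rewrite homeo_invK; left.
move=> g [Gg Dg gs]; exists (g ^ k); split; first exact: subgroupJ.
  have := @supp_inJ _ _ _ k Dg; rewrite -homeo_imageM mulVg.
  by apply: supp_inS => x; rewrite image_id.
by move=> x A'x /=; rewrite gs //; exists x.
Qed.

Lemma movable_small_nbhd s O x : G s -> clopen O -> O !=set0 -> supp_in (~` O) s ->
  exists A, [/\ clopen A, A x & movable A s].
Proof.
move=> Gs cO nO Os; have [O' [cO' O'O [o O'o] O'x]] := clopen_avoid x cO nO.
exists (~` O'); split=> //; first exact: (@clopenC _ O' O').
apply: movable_small_support Gs cO Os (@clopenC _ O' O' cO') _.
by exists o; split; [exact: O'O|apply].
Qed.

Definition locally_movable s := forall x, exists A, [/\ clopen A, A x & movable A s].

Lemma normal_locally_movable : normal_subgroup (G `&` locally_movable) G.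
Proof.
split; last first.
- move=> s k [Gs ls] Gk; split; first exact: subgroupJ.
  move=> x; have [A [cA Ax As]] := ls (k^-1 x).
  exists (k @` A); split; [exact: clopen_homeo| |exact: movableJ].
  by rewrite homeo_imageE.
- by move=> s [].
suff lM s t : G s -> locally_movable s -> locally_movable t -> locally_movable (s * t).
  apply/subgroupP; split.
    split; first exact: subgroup1.
    move=> x; exists setT; split=> //; first exact: clopenT.
    by move=> A' D _ _ _ _; exists 1; split=> //; exact: subgroup1.
  move=> s t [Gs ls] [Gt lt].
  have GtV : G t^-1 by exact: subgroupV.
  split; first exact: subgroupM.
  apply: lM => // x; have [A [cA Ax At]] := lt (t^-1 x).
  exists (t @` A); split; [exact: clopen_homeo| |exact: movableV].
  by rewrite homeo_imageE.
move=> Gs ls lt x.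
have [A [cA Ax As]] := ls x; have [B [cB Bx Bt]] := lt (s x).
(* [O] is shrunk three times to avoid [x], [s x] and [t (s x)], so that a clopen [A'] around [x]
   stays off [O] together with its two images. *)
have [O1 [cO1 _ nO1 O1x]] := clopen_avoid x (@clopenT T) (ex_intro _ x I).
have [O2 [cO2 O21 nO2 O2x]] := clopen_avoid (s x) cO1 nO1.
have [O [cO O32 nO Ox]] := clopen_avoid (t (s x)) cO2 nO2.
set A' := A `&` s^-1%g @` B `&` ~` O `&` s^-1%g @` (~` O) `&` s^-1%g @` (t^-1%g @` (~` O)).
have cCO : clopen (~` O) by exact: (@clopenC _ O O).
have cA' : clopen A' by do !apply: clopenI => //; do ?apply: clopen_homeo.
have sub : A' `|` s @` A' `|` t @` (s @` A') `<=` ~` O.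
  move=> y [[]|].
  - by case=> [[[[]]]].
  - case=> z [[_]] + _ <-; rewrite homeo_imageE; exact.
  - case=> _ [z [_]] + <- <-; rewrite !homeo_imageE; exact.
exists A'; split=> //.
  rewrite /A' !homeo_imageE; do 4?split=> //=.
    by move=> /O32/O21.
  by move=> /O32.
apply: (@movableM A' s t _ _ O cO nO _ cA') => //.
- by apply: movableS As => y [[[[]]]].
- apply: movableS Bt => _ [y [[[[_]]]] + _ _ _ <-]; rewrite homeo_imageE; exact.
- by move=> y Oy /sub.
Qed.

Lemma nontrivial_small_support : exists s O,
  [/\ G s, s <> 1, clopen O, O !=set0 & supp_in (~` O) s].
Proof.
have [V [cV _ nV nCV]] := splitT (@clopenT T) (ex_intro _ point I).
have [V1 [cV1 V1V [x V1x] nV2]] := splitT cV nV.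
have cV2 : clopen (V `\` V1) by exact: clopenD.
have [|g [Gg Vg gV]] := vigorous_move cV cV1 cV2 _ (@subDsetl _ V V1) nV2.
  by apply/properI_ex; split=> //; case: nV2 => y [Vy V1y]; exists y.
exists g, (~` V); split=> //.
- by move=> g1; have [_] := gV x V1x; rewrite g1; apply.
- exact: (@clopenC _ V V).
- by case: nCV => y [_ Vy]; exists y.
- by rewrite setCK.
Qed.

(** The locally movable elements form a normal subgroup containing a nontrivial element of small
    support, so simplicity makes it all of [G]. *)
Lemma locally_movableG g : G g -> locally_movable g.
Proof.
have [_ /(_ _ normal_locally_movable)[NE|<- []//]] := simpleG.
have [s [O [Gs s1 cO nO Os]]] := nontrivial_small_support.
case: s1; suff : (G `&` locally_movable) s by rewrite NE.
by split=> // x; exact: movable_small_nbhd nO Os.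
Qed.

(** These are the elements of the topological full group of [G]. *)
Definition local h :=
  forall x, exists A g, [/\ clopen A, A x, G g & forall y, A y -> h y = g y].

Lemma local_mem g : G g -> local g.
Proof. by move=> Gg x; exists setT, g; split=> //; exact: clopenT. Qed.

Lemma localM g h : local g -> local h -> local (g * h).
Proof.
move=> lg lh x; have [A [g' [cA Ax Gg' gE]]] := lg x.
have [B [h' [cB Bx Gh' hE]]] := lh (g x).
exists (A `&` g^-1%g @` B), (g' * h'); split.
- by apply: clopenI => //; exact: clopen_homeo.
- by split; rewrite ?homeo_imageE.
- exact: subgroupM.
- by move=> y [Ay]; rewrite homeo_imageE /= => Bgy; rewrite hE // gE.
Qed.

(** Induction over the clopen bound [A]. Two parts of [A'] are extended separately, with extra
    supports in disjoint parts of the free space of [D]. Since [A'] misses its image, neither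
    extension disturbs the other and their product works. *)
Lemma local_extend_disjoint h : local h -> forall A, clopen A ->
  forall A' D, A' `<=` A -> clopen A' -> (forall x, A' x -> ~ A' (h x)) ->
    clopen D -> A' `|` h @` A' `<` D ->
  exists g, [/\ G g, supp_in D g & forall x, A' x -> g x = h x].
Proof.
move=> lh; apply: (clopen_ind compactT).
- by move=> A B AB _ _ PB A' D A'A; apply: PB; exact: subset_trans AB.
- move=> A B cA cB PA PB A' D A'AB cA' disj cD /properI_ex[AD [d Dd dA]].
  set E := D `\` (A' `|` h @` A').
  have cE : clopen E.
    by apply: clopenD => //; apply: clopenU => //; exact: clopen_homeo.
  have [V [cV VE [v Vv] [e [Ee Ve]]]] := splitT cE (ex_intro _ d (conj Dd dA)).
  have sI : h @` (A' `&` A) `<=` h @` A' by apply: image_subset => x [].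
  have sD : h @` (A' `\` A) `<=` h @` A' by apply: image_subset => x [].
  have [g1 [Gg1 s1 gh1]] : exists g, [/\ G g,
      supp_in (A' `&` A `|` h @` (A' `&` A) `|` V) g &
      forall x, (A' `&` A) x -> g x = h x].
    apply: PA.
    - by move=> x [].
    - exact: clopenI.
    - by move=> x [A'x _] [A'hx _]; exact: (disj x).
    - by do !apply: clopenU => //; [|apply: clopen_homeo]; exact: clopenI.
    - apply/properI_ex; split; first by move=> x; left.
      exists v; first by right.
      by have [_ nv] := VE _ Vv; apply: contra_not nv => -[[]|/sI]; [left|right].
  have [g2 [Gg2 s2 gh2]] : exists g, [/\ G g,
      supp_in (A' `\` A `|` h @` (A' `\` A) `|` (E `\` V)) g &
      forall x, (A' `\` A) x -> g x = h x].
    apply: PB.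
    - by move=> x [/A'AB[]].
    - exact: clopenD.
    - by move=> x [A'x _] [A'hx _]; exact: (disj x).
    - by do !apply: clopenU => //; [|apply: clopen_homeo|]; exact: clopenD.
    - apply/properI_ex; split; first by move=> x; left.
      exists e; first by right.
      by case: Ee => _; apply: contra_not => -[[]|/sD]; [left|right].
  have A'h x : (h @` A') x -> A' x -> False.
    by rewrite homeo_imageE /= => /disj; rewrite homeo_invK.
  have hinj x : A' x -> (h @` (A' `\` A)) (h x) -> ~ A x.
    by rewrite homeo_imageE /= homeo_funK => _ [].
  have hinj' x : A' x -> (h @` (A' `&` A)) (h x) -> A x.
    by rewrite homeo_imageE /= homeo_funK => _ [].
  exists (g1 * g2); split; first exact: subgroupM.
    apply: supp_inM; [apply: supp_inS s1|apply: supp_inS s2] => x.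
    + by case=> [[[A'x _]|/sI hx]|/VE[]//]; apply: AD; [left|right].
    + by case=> [[[A'x _]|/sD hx]|[[]]//]; apply: AD; [left|right].
  move=> x A'x /=; have hx : (h @` A') (h x) by exists x.
  have [Ax|Ax] := pselect (A x).
    rewrite gh1 //; apply: s2 => -[[[]|]|[[_ nE _]]].
    - by move=> /(A'h _ hx).
    - by move=> /hinj; apply.
    - by apply: nE; right.
  rewrite (s1 x) ?gh2 // => -[[[]|]|/VE[_ nE]] //.
    by move=> /sI/A'h; apply.
  by apply: nE; left.
- move=> x; have [A [g [cA Ax Gg hE]]] := lh x.
  have [B [cB Bx Bg]] := locally_movableG Gg x.
  exists (A `&` B); split; [exact: clopenI|by []|].
  move=> A' D A'AB cA' disj cD A'D.
  have [||k [Gk Dk kg]] := Bg A' D _ cA' cD.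
  - by move=> y /A'AB[].
  - rewrite (_ : g @` A' = h @` A') //.
    by apply/seteqP; split=> _ [y A'y <-]; exists y; rewrite ?hE //; have [] := A'AB y A'y.
  by exists k; split=> // y A'y; rewrite kg // hE //; have [] := A'AB y A'y.
Qed.

(* Moving [A] into the free space [D \ (A U h A)] first makes domain and range
   disjoint. *)
Lemma local_extend h A D : local h -> clopen A -> clopen D -> A `|` h @` A `<` D ->
  exists g, [/\ G g, supp_in D g & forall x, A x -> g x = h x].
Proof.
move=> lh cA cD /properI_ex[AD [d Dd dA]].
set E := D `\` (A `|` h @` A).
have cE : clopen E.
  by apply: clopenD => //; apply: clopenU => //; exact: clopen_homeo.
have [V [cV VE nV [e [Ee Ve]]]] := splitT cE (ex_intro _ d (conj Dd dA)).
have [||g [Gg Dg gV]] := vigorous_move cD cA cV _ _ nV.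
- apply/properI_ex; split; first by move=> x Ax; apply: AD; left.
  by exists d => // Ad; apply: dA; left.
- by move=> x /VE[].
have lgh : local (g^-1 * h).
  by apply: localM => //; apply: local_mem; exact: subgroupV.
have gA x : (g @` A) x -> V x by case=> y /gV + <-.
have ghA : (g^-1 * h) @` (g @` A) = h @` A.
  by rewrite -homeo_imageM mulgA mulgV mul1g.
have cgA := clopen_homeo g cA.
have [||k [Gk Dk kh]] := @local_extend_disjoint _ lgh _ cgA _ D (@subset_refl _ _) cgA _ cD.
- move=> x gAx /gA/VE[_]; apply; right; rewrite -ghA.
  by exists x.
- rewrite ghA; apply/properI_ex; split.
    by move=> x [/gA/VE[]//|hx]; apply: AD; right.
  exists e; first by case: Ee.
  by move=> [/gA//|hx]; case: Ee => _; apply; right.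
exists (g * k); split; [exact: subgroupM|exact: supp_inM|].
move=> x Ax; rewrite [LHS]/= kh; last by exists x.
by rewrite /= homeo_funK.
Qed.

(* An extension of [h] in [G] differs from [h] only outside [X], and the two
   differences can be given disjoint supports. *)
Lemma local_comm X h k : local h -> local k -> clopen X -> X <> setT ->
  supp_in X h -> supp_in X k -> G [~ h, k].
Proof.
move=> lh lk cX nX Xh Xk.
have cCX : clopen (~` X) by exact: (@clopenC _ X X).
have nCX : ~` X !=set0.
  apply: contrapT => /nonemptyPn CX0; apply: nX.
  by rewrite -(setCK X) CX0 setC0.
have [Z [cZ ZX [z Zz] [y [Xy Zy]]]] := splitT cCX nCX.
have ext f W w : local f -> supp_in X f -> clopen W -> W `<=` ~` X -> W w ->
    exists2 d, supp_in W d & G (f * d).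
  move=> lf Xf cW WX Ww.
  have fX : f @` X = X.
    apply/seteqP; split=> [_ [x Xx <-]|x Xx]; first exact/(supp_in_mem _ Xf).
    by rewrite homeo_imageE; apply/(supp_in_mem _ (supp_inV Xf)).
  (* As [f] preserves [X], the extension [g] is supported in the union of [X] and [W], and
     [f^-1 * g] is trivial on [X]. *)
  have [|g [Gg Wg gf]] := @local_extend f X (X `|` W) lf cX (clopenU cX cW).
    rewrite fX setUid; apply/properI_ex; split; first by move=> x; left.
    by exists w; [right|exact: WX].
  exists (f^-1 * g); last by rewrite mulVKg.
  move=> x Wx /=; have [Xx|nXx] := pselect (X x).
    rewrite gf ?homeo_invK //.
    by apply/(supp_in_mem (f := f^-1) _ (supp_inV Xf)).
  have -> : homeo_inv f x = x by exact: (supp_inV Xf).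
  by apply: Wg => -[].
have [d Zd Ghd] := ext h Z z lh Xh cZ ZX Zz.
have [e Ze Gke] := ext k (~` X `\` Z) y lk Xk (clopenD cCX cZ) (@subDsetl _ _ _) (conj Xy Zy).
rewrite -(@commg_mul_commute _ h k d e).
- exact: subgroupR.
- by apply: supp_in_commute Zd Xh => x /ZX.
- by apply: supp_in_commute Zd Xk => x /ZX.
- by apply: supp_in_commute Zd Ze => x + [_]; exact.
- by apply: supp_in_commute Ze Xh => x [].
- by apply: supp_in_commute Ze Xk => x [].
Qed.

(** * Even permutations of disjoint copies *)

Section EvenPermutations.
Variables (n : nat) (A : set T) (gam : 'I_n -> homeo T).
Hypotheses (cA : clopen A) (dA : disjoint_pieces A gam) (Ggam : forall i, G (gam i)).

Lemma local_perm_pieces pi : local (perm_pieces cA dA pi).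
Proof.
move=> x; have [B [h [cB Bx hE fh]]] := perm_pieces_fun_local cA dA pi x.
exists B, h; split=> //; case: hE => [->|[i [j ->]]]; first exact: subgroup1.
by apply: subgroupM => //; exact: subgroupV.
Qed.

Hypothesis nA : pieces A gam <> setT.

Lemma perm_pieces_comm s t : G (perm_pieces cA dA [~ s, t]).
Proof.
rewrite perm_piecesR.
apply: (local_comm _ _ (clopen_pieces gam cA) nA);
  by [exact: local_perm_pieces|exact: supp_in_perm_pieces].
Qed.

(* The product of a transposition and a conjugate of it is a commutator. *)
Lemma perm_pieces_even pi : odd_perm pi = false -> G (perm_pieces cA dA pi).
Proof.
have [ts -> dts] := prod_tpermP pi; rewrite odd_perm_prod // => ots.
have [m] := ubnP (size ts); elim: m ts dts ots => // m IH [|t1 [|t2 ts]] //= dts ots lem.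
  by rewrite big_nil perm_pieces1; exact: subgroup1.
case/and3P: dts => d1 d2 dts.
rewrite !big_cons mulgA perm_piecesM; apply: subgroupM => //; last first.
  by apply: IH => //; [rewrite negbK in ots|exact: ltnW].
case: t1 t2 d1 d2 => [i j] [k l] /= ij kl.
(* The first factor sends [i] to [k]; the second corrects the image of [j] to [l] without moving
   [k]. *)
pose s := tperm i k * tperm (tperm i k j) l.
have sE : tperm i j ^ s = tperm k l.
  have si : s i = k.
    rewrite permM tpermL tpermD // 1?eq_sym //.
    by rewrite -[X in X != _](tpermL i k) (inj_eq perm_inj).
  by rewrite tpermJ si permM tpermL.
rewrite -sE -{1}(tpermV i j) -commgEl.
exact: perm_pieces_comm.
Qed.

End EvenPermutations.

(** * Double swaps and the subgroups they generate *)

Let o0 := @Ordinal 6 0 isT.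
Let o1 := @Ordinal 6 1 isT.
Let o2 := @Ordinal 6 2 isT.
Let o3 := @Ordinal 6 3 isT.
Let o4 := @Ordinal 6 4 isT.
Let o5 := @Ordinal 6 5 isT.

(* Four of the six pieces are moved; the other two make a double swap a
   commutator of double swaps. *)
Definition double_swaps U : set (homeo T) := [set q | exists A
  (gam : 'I_6 -> homeo T) (cA : clopen A) (dA : disjoint_pieces A gam),
  [/\ forall i, G (gam i), pieces A gam `<` U &
      q = perm_pieces cA dA (tperm o0 o1 * tperm o2 o3)]].

Lemma proper_neqT A U : A `<` U -> A <> setT.
Proof. by move=> /properI_ex[_ [x _ nAx]] AT; apply: nAx; rewrite AT. Qed.

Lemma double_swaps_mem U q : double_swaps U q -> G q.
Proof.
move=> [A [gam [cA [dA [Ggam /proper_neqT nA ->]]]]].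
by apply: perm_pieces_even => //; rewrite odd_permM !odd_tperm.
Qed.

Lemma double_swaps_supp U q : double_swaps U q -> supp_in U q.
Proof.
move=> [A [gam [cA [dA [Ggam [AU _] ->]]]]].
by apply: (supp_inS AU); exact: supp_in_perm_pieces.
Qed.

Lemma double_swapsS U V : U `<=` V -> double_swaps U `<=` double_swaps V.
Proof.
move=> UV q [A [gam [cA [dA [Ggam AU ->]]]]]; exists A, gam, cA, dA; split=> //.
case/properI_ex: AU => AU [x Ux Ax]; apply/properI_ex; split.
  exact: (subset_trans AU).
by exists x; [exact: UV|].
Qed.

Lemma double_swapsJ U q k : G k -> double_swaps U q -> double_swaps (k @` U) (q ^ k).
Proof.
move=> Gk [A [gam [cA [dA [Ggam AU ->]]]]].
exists A, (fun i => gam i * k), cA, (disjoint_pieces_mul dA k); split.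
- by move=> i; exact: subgroupM.
- rewrite pieces_mul; case/properI_ex: AU => AU [x Ux Ax]; apply/properI_ex.
  split; first exact: image_subset.
  by exists (k x); [exists x|rewrite homeo_imageE /= homeo_funK].
- by rewrite perm_piecesJ.
Qed.

Lemma double_swap_sqr U q : double_swaps U q -> q ^+ 2 = 1.
Proof.
move=> [A [gam [cA [dA [_ _ ->]]]]].
rewrite -perm_piecesX (_ : (_ ^+ 2) = 1 :> 'S_6) ?perm_pieces1 //.
by apply/perm.permP => -[[|[|[|[|[|[|//]]]]]] ?]; rewrite ?permM ?permE /=; exact: val_inj.
Qed.

Lemma double_swap_comm U q : double_swaps U q ->
  exists x y, [/\ double_swaps U x, double_swaps U y & q = [~ x, y]].
Proof.
move=> [A [gam [cA [dA [Ggam AU ->]]]]].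
(* These relabellings give [x] = (01)(45) and [y] = (02)(13), whose commutator is (01)(45)(23)(45) =
   (01)(23). *)
pose s := tperm o2 o4 * tperm o3 o5; pose t := tperm o1 o2.
pose x := perm_pieces cA (disjoint_pieces_perm dA s) (tperm o0 o1 * tperm o2 o3).
pose y := perm_pieces cA (disjoint_pieces_perm dA t) (tperm o0 o1 * tperm o2 o3).
exists x, y; split.
- exists A, (gam \o s), cA, (disjoint_pieces_perm dA s).
  by split; rewrite ?pieces_perm // => i; exact: Ggam.
- exists A, (gam \o t), cA, (disjoint_pieces_perm dA t).
  by split; rewrite ?pieces_perm // => i; exact: Ggam.
rewrite /x /y !perm_pieces_reindex -perm_piecesR; congr (perm_pieces _ _ _).
rewrite !conjMg !tpermJ !permM.
have [-> -> -> ->] : [/\ tperm o3 o5 (tperm o2 o4 o0) = o0,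
    tperm o3 o5 (tperm o2 o4 o1) = o1, tperm o3 o5 (tperm o2 o4 o2) = o4 &
    tperm o3 o5 (tperm o2 o4 o3) = o5] by rewrite !permE.
have [-> -> -> ->] : [/\ t o0 = o0, t o1 = o2, t o2 = o1 & t o3 = o3].
  by rewrite !permE.
rewrite commgEl conjgE !invgM !tpermV.
apply/perm.permP => -[[|[|[|[|[|[|//]]]]]] ?]; rewrite ?permM ?permE /=; exact: val_inj.
Qed.

(** [O] is split repeatedly, one part being kept each time; the discarded parts form the
    sequence. *)
Lemma clopen_sequence O : clopen O -> O !=set0 -> exists F : nat -> set T,
  (forall i, [/\ clopen (F i), F i `<=` O & F i !=set0]) /\
  (forall i j x, F i x -> F j x -> i = j).
Proof.
move=> cO nO.
have halfE : forall P : set T, exists V, clopen P -> P !=set0 ->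
    [/\ clopen V, V `<=` P, V !=set0 & (P `\` V) !=set0].
  move=> P; have [[cP nP]|nP] := pselect (clopen P /\ P !=set0).
    by have [V VP] := splitT cP nP; exists V.
  by exists set0 => cP neP; case: nP.
have [half halfP] := choice halfE; pose E i := iter i half O.
have EP i : clopen (E i) /\ E i !=set0.
  by elim: i => //= i [cE nE]; have [] := halfP _ cE nE.
have ES i : E i.+1 `<=` E i by have [cE nE] := EP i; have [] := halfP _ cE nE.
have Ele i j : i <= j -> E j `<=` E i.
  move=> /subnK <-; elim: (j - i) => [|k IH] //.
  by rewrite addSn; exact: subset_trans (ES _) IH.
exists (fun i => E i `\` E i.+1); split=> [i|i j x [Ei nEi] [Ej nEj]].
  have [cE nE] := EP i; have [cE' _ _ nD] := halfP _ cE nE; split=> //.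
    exact: clopenD.
  by move=> x [/(Ele 0 i (leq0n i))].
by case: (ltngtP i j) => // ij; [case: nEi|case: nEj]; exact: Ele Ej || exact: Ele Ei.
Qed.

(** Vigour moves [B] into the members of a disjoint sequence inside [O]; member 0 is spared as
    [O']. *)
Lemma disjoint_copies B O : clopen B -> B <> setT -> clopen O -> O !=set0 ->
  exists (gam : nat -> homeo T) O',
  [/\ forall i, G (gam i), forall i x, B x -> (O `\` O') (gam i x),
      forall i j x y, B x -> B y -> gam i x = gam j y -> i = j &
      [/\ clopen O', O' `<=` O & O' !=set0]].
Proof.
move=> cB nB cO nO; have [F [FP Fdisj]] := clopen_sequence cO nO.
have gamE : forall i, exists g, G g /\ forall x, B x -> F i.+1 (g x).
  move=> i; have [cF FO nF] := FP i.+1.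
  have [||g [Gg _ gF]] := @vigorous_move setT B (F i.+1) clopenT cB cF _ _ nF.
  - by split=> // TB; apply: nB; apply/seteqP.
  - by [].
  by exists g.
have [gam gamP] := choice gamE; have [cF0 F0O nF0] := FP 0.
exists gam, (F 0); split=> //.
- by move=> i; have [] := gamP i.
- move=> i x Bx; have [_ /(_ x Bx) Fx] := gamP i; split.
    by have [_ + _] := FP i.+1; apply.
  by move=> /(Fdisj _ _ _ Fx).
- move=> i j x y Bx By gxy.
  have [_ /(_ x Bx) Fx] := gamP i; have [_ /(_ y By)] := gamP j.
  by rewrite -gxy => /(Fdisj _ _ _ Fx) [].
Qed.

Lemma disjoint_copies_id B O : clopen B -> (forall x, B x -> ~ O x) -> clopen O ->
    O !=set0 ->
  exists (gam : nat -> homeo T) O',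
  [/\ gam 0 = 1, forall i, G (gam i), forall i x, B x -> (O `\` O') (gam i.+1 x),
      forall i j x y, B x -> B y -> gam i x = gam j y -> i = j &
      [/\ clopen O', O' `<=` O & O' !=set0]].
Proof.
move=> cB BO cO nO.
have nB : B <> setT by case: nO => x Ox BT; apply: (BO x) => //; rewrite BT.
have [gam [O' [Ggam gamO gamd [cO' O'O nO']]]] := disjoint_copies cB nB cO nO.
exists (fun i => if i is j.+1 then gam j else 1), O'; split=> // [[|i]//|].
- exact: subgroup1.
- move=> [|i] [|j] x y Bx By //= gxy.
  + by case: (BO x) => //; rewrite gxy; have [] := gamO j y By.
  + by case: (BO y) => //; rewrite -gxy; have [] := gamO i x Bx.
  + by rewrite (gamd i j x y).
Qed.

(** Piece 0 is [B] itself and the other five are copies in [O]; the spared [O'] keeps the support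
    proper. *)
Lemma double_swap_move B O : clopen B -> (forall x, B x -> ~ O x) -> clopen O -> O !=set0 ->
  exists2 q, (forall V, B `|` O `<=` V -> double_swaps V q) & forall x, B x -> O (q x).
Proof.
move=> cB BO cO nO.
have [gam [O' [gam0 Ggam gamO gamd [cO' O'O [o O'o]]]]] := disjoint_copies_id cB BO cO nO.
pose gam6 (i : 'I_6) := gam i.
have dB : disjoint_pieces B gam6.
  by move=> i j x y Bx By /(gamd _ _ _ _ Bx By) /val_inj.
exists (perm_pieces cB dB (tperm o0 o1 * tperm o2 o3)) => [V BOV|x Bx].
  exists B, gam6, cB, dB; split=> //; first by move=> i; exact: Ggam.
  have pO : pieces B gam6 `<=` B `|` O `\` O'.
    move=> _ [[[|i] ?] [x Bx <-]]; rewrite /gam6 /=; first by rewrite gam0; left.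
    by right; exact: gamO.
  apply/properI_ex; split; first by move=> x /pO[Bx|[Ox _]]; apply: BOV; [left|right].
  exists o; first by apply: BOV; right; exact: O'O.
  by move=> /pO[/BO|[]//]; apply; exact: O'O.
have -> : x = gam6 o0 x by rewrite /gam6 /= gam0.
rewrite perm_piecesE // permM tpermL tpermD //.
by have [] := gamO 0 x Bx.
Qed.

(** [B] may meet [O], so it travels through a set [P] disjoint from [B] that does not exhaust
    [O]. *)
Lemma double_swaps_vigorous B U O : clopen B -> clopen U -> clopen O -> B `<` U -> O `<=` U ->
  O !=set0 -> exists2 k, generated (double_swaps U) k & forall x, B x -> O (k x).
Proof.
move=> cB cU cO /properI_ex[BU [u Uu Bu]] OU nO.
have sg := subgroup_generated (double_swaps U).
have cUB : clopen (U `\` B) by exact: clopenD.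
have [W [cW WUB nW nUBW]] := splitT cUB (ex_intro _ u (conj Uu Bu)).
(* Either [W] leaves a point of [O] outside, or it contains [O] and the other part of the complement
   of [B] misses [O]. *)
have [P [cP PUB nP nOP]] : exists P : set T,
    [/\ clopen P, P `<=` U `\` B, P !=set0 & (O `\` P) !=set0].
  have [nOW|OW] := pselect ((O `\` W) !=set0).
    by exists W; split.
  exists (U `\` B `\` W); split=> //; first exact: clopenD.
  case: nO => x Ox; exists x; split=> // -[_ Wx]; apply: OW; exists x.
  by split.
have [|q1 q1U q1P] := double_swap_move cB _ cP nP.
  by move=> x Bx /PUB[].
have [|q2 q2U q2P] := double_swap_move cP _ (clopenD cO cP) nOP.
  by move=> x Px [].
exists (q1 * q2).
  apply: (subgroupM sg); apply: sub_generated.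
    by apply: q1U => x [/BU//|/PUB[]].
  by apply: q2U => x [/PUB[]//|[/OU]].
by move=> x Bx /=; have [] := q2P (q1 x) (q1P x Bx).
Qed.

Lemma generated_double_swaps_mem U : generated (double_swaps U) `<=` G.
Proof. by apply: generated_sub => // q; exact: double_swaps_mem. Qed.

Lemma generated_double_swaps_supp U q : generated (double_swaps U) q -> supp_in U q.
Proof.
move: q; apply: generated_sub => [|q]; first exact: subgroup_supp_in.
exact: double_swaps_supp.
Qed.

(** Conjugation by [G] preserves the set of double swaps, so they generate a nontrivial normal
    subgroup. *)
Lemma generated_double_swapsT : generated (double_swaps setT) = G.
Proof.
have [V [cV _ nV nCV]] := splitT (@clopenT T) (ex_intro _ point I).
have [|q qV qE] := double_swap_move (O := setT `\` V) cV _ (clopenD clopenT cV) nCV.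
  by move=> x Vx [].
have q1 : q <> 1.
  by case: nV => x Vx q1; have [_] := qE x Vx; rewrite q1; apply.
have [_ /(_ (generated (double_swaps setT)))[|D1|//]] := simpleG.
  split; [exact: subgroup_generated|exact: generated_double_swaps_mem|].
  apply: generated_normalized => // s x Qs Gx.
  by apply: double_swapsS (double_swapsJ Gx Qs).
case: q1; suff : generated (double_swaps setT) q by rewrite D1.
by apply: sub_generated; exact: qV.
Qed.

(** The pieces cannot contain both [X] and [Y]. If they do not contain [X], a product of double
    swaps in [X] pushes their part in [X] into the overlap, which conjugates the given swap into
    [Y]. *)
Lemma double_swapsU H X Y : subgroup H -> clopen X -> clopen Y -> X `&` Y !=set0 ->
    double_swaps X `<=` H -> double_swaps Y `<=` H -> double_swaps (X `|` Y) `<=` H.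
Proof.
move=> sH.
suff one X' Y' : clopen X' -> clopen Y' -> X' `&` Y' !=set0 ->
    double_swaps X' `<=` H -> double_swaps Y' `<=` H ->
    forall A (gam : 'I_6 -> homeo T) (cA : clopen A) (dA : disjoint_pieces A gam),
    (forall i, G (gam i)) -> pieces A gam `<=` X' `|` Y' -> ~ (X' `<=` pieces A gam) ->
    H (perm_pieces cA dA (tperm o0 o1 * tperm o2 o3)).
  move=> cX cY nXY HX HY q [A [gam [cA [dA [Ggam [AXY nA] ->]]]]].
  have [XA|XA] := pselect (X `<=` pieces A gam); last exact: (one X Y).
  apply: (one Y X) => //; [by rewrite setIC|by rewrite setUC|].
  by move=> YA; apply: nA => x [/XA|/YA].
move=> cX cY nXY HX HY A gam cA dA Ggam AXY nXA.
set P := pieces A gam.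
have cP : clopen P by exact: clopen_pieces.
(* Only a part [O] of the overlap is used, so that [z] remains to make the new support proper in
   [Y]. *)
have [O [cO OXY nO [z [[Xz Yz] Oz]]]] := splitT (clopenI cX cY) nXY.
have [||k Qk kP] := double_swaps_vigorous (clopenI cP cX) cX cO _ _ nO.
- split; first by move=> x [].
  by move=> XPX; apply: nXA => x /XPX[].
- by move=> x /OXY[].
have Xk := generated_double_swaps_supp Qk.
have Gk := generated_double_swaps_mem Qk.
have Hk : H k by apply: generated_sub Qk.
rewrite -(conjgK k (perm_pieces cA dA _)); apply: subgroupJ => //; last exact: subgroupV.
apply: HY; rewrite perm_piecesJ; exists A, (fun i => gam i * k), cA, (disjoint_pieces_mul dA k).
split=> //; first by move=> i; exact: subgroupM.
have Pk x : P x -> O (k x) \/ ~ X' (k x) /\ Y' (k x).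
  move=> Px; have [Xx|Xx] := pselect (X' x); first by left; exact: kP.
  by right; rewrite Xk //; split=> //; case: (AXY x Px).
rewrite pieces_mul; apply/properI_ex; split.
  by move=> _ [x /Pk[/OXY[_ ?]|[_ ?]] <-].
by exists z => // -[x /Pk + xz]; rewrite xz => -[//|[]].
Qed.

(** Needed because spreading involutions yields only commutators of the group they generate. *)
Lemma double_swaps_comm_seq U (l : seq (homeo T)) : [set` l] `<=` double_swaps U ->
  exists2 l' : seq (homeo T), [set` l'] `<=` double_swaps U &
    forall q, q \in l -> exists x y, [/\ x \in l', y \in l' & q = [~ x, y]].
Proof.
elim: l => [|q l IH] lU; first by exists [::].
have [|l' l'U lE] := IH; first by move=> z /= zl; apply: lU; rewrite /= inE zl orbT.
have [|x [y [Ux Uy qE]]] := @double_swap_comm U q; first by apply: lU; rewrite /= mem_head.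
exists [:: x, y & l'] => [z /=|p].
  by rewrite !inE => /or3P[/eqP->|/eqP->|/l'U].
rewrite inE => /predU1P[->|/lE[x' [y' [x'l y'l ->]]]].
  by exists x, y; rewrite !inE !eqxx orbT.
by exists x', y'; rewrite !inE x'l y'l !orbT.
Qed.

(** * Rotations as products of two involutions, and generation *)

Lemma rotation_involutions t (n := (4 * t ^ 2).+1%N) A (gam : nat -> homeo T)
    (span := [set x | exists2 i, i < n & (gam i @` A) x]) :
    clopen A -> (forall i, i < n -> G (gam i)) ->
    (forall i j x y, i < n -> j < n -> A x -> A y -> gam i x = gam j y -> i = j) ->
    span <> setT ->
  exists a b, [/\ G a /\ G b, a ^+ 2 = 1, b ^+ 2 = 1, supp_in span a /\ supp_in span b &
    forall m i x, i < n -> A x -> ((a * b) ^+ m) (gam i x) = gam ((i + m) %% n) x].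
Proof.
move=> cA Ggam dgam nspan.
pose g (i : 'I_n) := gam i.
have Gg i : G (g i) by exact: Ggam.
have dA : disjoint_pieces A g.
  by move=> i j x y Ax Ay gxy; apply: val_inj; apply: (dgam i j x y) => /=.
have spanE : pieces A g = span.
  apply/seteqP; split=> x; first by move=> [i ix]; exists (val i); [exact: ltn_ord|exact: ix].
  by move=> [i ni ix]; exists (Ordinal ni).
have [r [r' [er er' r2 r'2 rr']]] := rotation_even_reflections t.
exists (perm_pieces cA dA r), (perm_pieces cA dA r'); split.
- by split; apply: perm_pieces_even => //; rewrite spanE.
- by rewrite -perm_piecesX r2 perm_pieces1.
- by rewrite -perm_piecesX r'2 perm_pieces1.
- by rewrite -spanE; split; exact: supp_in_perm_pieces.
- move=> m i x ni Ax; rewrite -perm_piecesM -perm_piecesX.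
  rewrite (_ : gam i x = g (Ordinal ni) x) // perm_piecesE //.
  by rewrite /g rr'.
Qed.

(* As U is the union of X and its image under g, finitely many double swaps in X
   suffice together with g; these are captured by spreading them over disjoint
   copies of X in the complement of X in U. *)
Lemma double_swaps_capture U (l : seq (homeo T)) : clopen U -> U !=set0 ->
    [set` l] `<=` double_swaps U ->
  exists s : nat -> homeo T, [/\ forall i, [/\ G (s i), supp_in U (s i) & s i ^+ 2 = 1],
    s 0 <> 1 & [set` l] `<=` generated [set s i | i in [set i | i < 4]]].
Proof.
move=> cU nU lU.
have [R [cR RU [r Rr] nX]] := splitT cU nU; set X := U `\` R in nX.
have cX : clopen X by exact: clopenD.
have [O [cO OX nO [z [Xz Oz]]]] := splitT cX nX.
have XR x : X x -> ~ R x by case.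
have [|g gQ gO] := @double_swap_move R O cR _ cO nO; first by move=> x Rx /OX/XR; apply.
have gU : double_swaps U g by apply: gQ => x [/RU//|/OX[]].
have Gg := double_swaps_mem gU; have Ug := double_swaps_supp gU.
have g2 := double_swap_sqr gU.
have gg x : g (g x) = x by have := congr1 (fun h : homeo T => h x) g2.
have XU : U = X `|` g @` X.
  apply/seteqP; split=> x.
    move=> Ux; have [Rx|Rx] := pselect (R x); last by left.
    by right; exists (g x); [apply: OX; exact: gO|exact: gg].
  by move=> [[]//|[y [Uy _] <-]]; apply/(supp_in_mem _ Ug).
have lX : [set` l] `<=` generated ([set g] `|` double_swaps X).
  set H := generated _; have sH : subgroup H by exact: subgroup_generated.
  (* [X] and its image under [g] meet: [g] fixes [z], which lies outside both [R] and [O]. *)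
  have Hg : H g by apply: sub_generated; left.
  have HX : double_swaps X `<=` H by move=> q Xq; apply: sub_generated; right.
  apply: (subset_trans lU); rewrite {1}XU; apply: double_swapsU => //.
  - exact: clopen_homeo.
  - exists z; split=> //; exists z => //.
    have gS := double_swaps_supp (gQ _ (@subset_refl _ (R `|` O))).
    by apply: gS => -[/(XR _ Xz)|].
  - move=> q qY; rewrite -(conjgKV g q); apply: (subgroupJ sH) => //; apply: HX.
    have := double_swapsJ (subgroupV subgroupG Gg) qY.
    by rewrite -homeo_imageM mulgV image_id.
have [l2 l2X ll2] := generated_finites lX.
have [l3 l3X l2l3] := double_swaps_comm_seq l2X.
have [gam [O' [gam0 Ggam gamR gamd [cO' O'R [o O'o]]]]] :=
  disjoint_copies_id cX XR cR (ex_intro _ r Rr).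
(* With this [t] there are at least [2 ^ m] copies of [X], enough to spread the [m] swaps of
   [l3]. *)
set m := size l3; set t := (2 ^ m)%N.
set n := (4 * t ^ 2).+1%N.
have mn : 2 ^ m <= n by rewrite /n -/t; nia.
have spanU x : (exists2 i, i < n & (gam i @` X) x) -> U x /\ ~ O' x.
  case=> -[|i] _ [y Xy <-]; first by rewrite gam0 /=; split; [case: Xy|move=> /O'R; exact: XR].
  by have [Ry nO'y] := gamR i y Xy; split=> //; exact: RU.
have [|||a [b [[Ga Gb] a2 b2 [sa sb] abE]]] := @rotation_involutions t X gam cX.
- by move=> i _; exact: Ggam.
- by move=> i j x y _ _; exact: gamd.
- by move=> spT; have [|_] := spanU o; [rewrite -/n; move/seteqP: spT => [_ /(_ o I)]|apply].
have Ua : supp_in U a by apply: supp_inS sa => x /spanU[].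
have Ub : supp_in U b by apply: supp_inS sb => x /spanU[].
pose s i := nth 1 l3 i.
have sX i : i < m -> double_swaps X (s i) by move=> im; apply: l3X; exact: mem_nth.
have [|||c [c2 cH cK _]] := @spread_involution _ X (a * b) m s.
- by move=> i /sX/double_swaps_supp.
- by move=> i /sX/double_swap_sqr.
- move=> e /andP[e0 em] x Xx.
  have x0 : gam 0 x = x by rewrite gam0.
  have en : e < n by exact: (leq_trans em).
  have := abE e 0 x (ltn0Sn _) Xx; rewrite x0 add0n -/n modn_small // => -> Xe.
  have : e = 0 by apply: (gamd _ _ x (gam e x)) => //; rewrite gam0.
  by move=> eE; rewrite eE in e0.
have Gc : G c.
  by apply: cH => //; [exact: subgroupM|move=> i /sX/double_swaps_mem].
have Uc : supp_in U c.
  apply: cH; [exact: subgroup_supp_in|exact: supp_inM|].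
  by move=> i /sX/double_swaps_supp; apply: supp_inS => x [].
(* [g] comes first because it is known to be nontrivial; the default 1 keeps all conditions true
   beyond index 3. *)
pose s4 i := nth 1 [:: g; a; b; c] i.
exists s4; split.
- move=> [|[|[|[|i]]]]; rewrite /s4 /= ?nth_nil; split=> //; first exact: subgroup1.
  exact: mulg1.
- rewrite /s4 /= => g1; have := OX _ (gO r Rr); rewrite g1 => /XR; exact.
set K := generated _; have sK : subgroup K by exact: subgroup_generated.
have Ks i : i < 4 -> K (s4 i) by move=> i4; apply: sub_generated; exists i.
apply: (subset_trans ll2); apply: generated_sub => // q [->|/= ql2].
  exact: (Ks 0 isT).
have [x [y [xl yl ->]]] := l2l3 q ql2.
apply: cK => //.
- by apply: (subgroupM sK); [exact: (Ks 1%N isT)|exact: (Ks 2 isT)].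
- exact: (Ks 3 isT).
- by apply: sub_generated; exists (index x l3); rewrite /= ?index_mem // /s nth_index.
- by apply: sub_generated; exists (index y l3); rewrite /= ?index_mem // /s nth_index.
Qed.

Lemma clopen_exists_lt n (F : nat -> set T) : (forall i, i < n -> clopen (F i)) ->
  clopen [set x | exists2 i, i < n & F i x].
Proof.
move=> cF; rewrite (_ : mkset _ = [set x | exists i : 'I_n, F i x]).
  by apply: clopen_exists => i; exact: cF.
apply/seteqP; split=> x [i]; first by move=> ni Fx; exists (Ordinal ni).
by exists (val i); [exact: ltn_ord|].
Qed.

(* Write [T] as n copies of [U] and a remainder F, and take 4 n copies of F out
   of each copy of [U]. The rotation of what is left of the n copies of [U] and
   the rotation of the 4 n ^ 2 + 1 copies of F combine into [w], under which
   the translates of [U] cover [T] although the first n of them are disjoint. *)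
Lemma covering_rotation t (n := (4 * t ^ 2).+1%N) : 0 < t ->
  exists U a b, [/\ clopen U /\ U !=set0, [/\ G a, G b, a ^+ 2 = 1 & b ^+ 2 = 1],
    forall m, 0 < m < n -> forall x, U x -> ~ U (((a * b) ^+ m) x),
    (exists2 x, U x & U (((a * b) ^+ n) x)) /\
    (exists2 x, U x & U (((a * b) ^+ n.+1) x)) &
    forall x, exists2 m, m <= n & (((a * b) ^+ m) @` U) x].
Proof.
move=> t0.
have [U [cU _ [u Uu] [v [_ Uv]]]] := splitT (@clopenT T) (ex_intro _ point I).
have cCU : clopen (~` U) by exact: (@clopenC _ _ set0).
have [|eps [O [eps0 Geps epsO epsd [cO OU [o Oo]]]]] :=
  @disjoint_copies_id U (~` U) cU _ cCU (ex_intro _ v Uv); first by move=> x Ux; apply.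
have epsUO i x : U x -> ~ O (eps i x).
  case: i => [|i] Ux; first by rewrite eps0 => /OU; apply.
  by have [] := epsO i x Ux.
set F := ~` [set x | exists2 i, i < n & (eps i @` U) x].
have cF : clopen F.
  apply: (@clopenC _ _ set0); apply: clopen_exists_lt => i _; exact: clopen_homeo.
have FO : F o by move=> [i _ [x Ux xo]]; apply: (epsUO i x Ux); rewrite xo.
have FepsU i x : i < n -> U x -> ~ F (eps i x).
  by move=> ni Ux; apply; exists i => //; exists x.
have FU x : F x -> ~ U x by move=> Fx Ux; apply: (FepsU 0 x) => //; rewrite eps0.
have nF : F <> setT by move=> FT; apply: (FU u) => //; rewrite FT.
have [phi [O' [Gphi phiU phid [cO' O'U [o' O'o]]]]] :=
  disjoint_copies cF nF cU (ex_intro _ u Uu).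
have phiUU j x : F x -> U (phi j x) by move=> Fx; have [] := phiU j x Fx.
set A := U `\` [set x | exists2 j, j < 4 * n & (phi j @` F) x].
have cA : clopen A.
  by apply: clopenD => //; apply: clopen_exists_lt => j _; exact: clopen_homeo.
have AU x : A x -> U x by case.
have Ao : A o'.
  split; first exact: O'U.
  by move=> [j _ [x Fx xo]]; have [_] := phiU j x Fx; rewrite xo.
have Aphi j x : j < 4 * n -> F x -> ~ A (phi j x).
  by move=> nj Fx [_]; apply; exists j => //; exists x.
(* Index [j * n + i] is copy [j] of F inside copy [i] of [U], and the last index is F itself. The
   total [4 * n ^ 2 + 1] has the form needed for a rotation. *)
pose del m := if m < 4 * n ^ 2 then phi (m %/ n) * eps (m %% n) else 1.
have delE j i x : j < 4 * n -> i < n -> del (j * n + i)%N x = eps i (phi j x).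
  move=> nj ni; rewrite /del ifT; last by nia.
  by rewrite divnMDl // divn_small // addn0 modnMDl modn_small.
have delF x : del (4 * n ^ 2)%N x = x by rewrite /del ltnn.
have delP m : m < (4 * n ^ 2).+1 -> m = (4 * n ^ 2)%N \/
    exists j i, [/\ j < 4 * n, i < n & m = (j * n + i)%N].
  rewrite ltnS leq_eqVlt => /predU1P[->|lem]; [by left|right].
  exists (m %/ n), (m %% n); split; [|exact: ltn_pmod|exact: divn_eq].
  by rewrite ltn_divLR //; nia.
have deld i j x y : i < (4 * n ^ 2).+1 -> j < (4 * n ^ 2).+1 -> F x -> F y ->
    del i x = del j y -> i = j.
  move=> /delP[->|[i1 [i2 [li1 li2 ->]]]] /delP[->|[j1 [j2 [lj1 lj2 ->]]]] Fx Fy //;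
    rewrite ?delE ?delF // => xy.
  - by case: (@FepsU j2 (phi j1 y)) => //; [exact: phiUU|rewrite -xy].
  - by case: (@FepsU i2 (phi i1 x)) => //; [exact: phiUU|rewrite xy].
  have ij2 : i2 = j2 by apply: epsd xy; exact: phiUU.
  by move: xy; rewrite ij2 => /homeo_inj/(phid _ _ _ _ Fx Fy) ->.
have disj i m x y : i < n -> m < (4 * n ^ 2).+1 -> A x -> F y -> eps i x <> del m y.
  move=> ni /delP[->|[j1 [j2 [lj1 lj2 ->]]]] Ax Fy; rewrite ?delE ?delF // => xy.
    by case: (@FepsU i x) => //; [exact: AU|rewrite xy].
  have ij : i = j2 by apply: epsd xy; [exact: AU|exact: phiUU].
  move: xy; rewrite ij => /homeo_inj xy.
  by apply: (@Aphi j1 y) => //; rewrite -xy.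
have [|||a1 [b1 [[Ga1 Gb1] a12 b12 [sa1 sb1] ab1]]] := @rotation_involutions t A eps cA.
- by move=> i _; exact: Geps.
- by move=> i j x y _ _ Ax Ay; apply: epsd; exact: AU.
- move=> spT; have : [set: T] o by [].
  rewrite -spT => -[i ni [x Ax xo]].
  by apply: (disj i (4 * n ^ 2)%N x o) => //; rewrite delF.
have [|||a2 [b2 [[Ga2 Gb2] a22 b22 [sa2 sb2] ab2]]] := @rotation_involutions n F del cF.
- move=> i _; rewrite /del; case: ifP => _; last exact: subgroup1.
  by apply: subgroupM => //.
- exact: deld.
- move=> spT; have : [set: T] o' by [].
  rewrite -spT => -[i ni [x Fx xo]].
  by apply: (disj 0 i o' x) => //; rewrite eps0 xo.
have dspan x : [set x | exists2 i, i < n & (eps i @` A) x] x ->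
    [set x | exists2 i, i < (4 * n ^ 2).+1 & (del i @` F) x] x -> False.
  by move=> [i ni [y Ay <-]] [m nm [z Fz]] /esym; exact: disj.
have cZ a b : supp_in [set x | exists2 i, i < n & (eps i @` A) x] a ->
    supp_in [set x | exists2 i, i < (4 * n ^ 2).+1 & (del i @` F) x] b -> commute a b.
  exact: supp_in_commute.
have wE m : (a1 * a2 * (b1 * b2)) ^+ m = (a1 * b1) ^+ m * (a2 * b2) ^+ m.
  rewrite -expgMn; last by apply: cZ; exact: supp_inM.
  by rewrite !mulgA -(mulgA a1 a2) -(cZ b1 a2) // !mulgA.
have wA m i x : i < n -> A x -> ((a1 * a2 * (b1 * b2)) ^+ m) (eps i x) = eps ((i + m) %% n) x.
  move=> ni Ax; rewrite wE.
  have -> : ((a1 * b1) ^+ m * (a2 * b2) ^+ m) (eps i x) =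
    ((a2 * b2) ^+ m) (((a1 * b1) ^+ m) (eps i x)) by [].
  rewrite ab1 // (supp_inX m (supp_inM sa2 sb2)) // => /dspan; apply.
  by exists ((i + m) %% n); [exact: ltn_pmod|exists x].
have wF m i x : i < (4 * n ^ 2).+1 -> F x ->
    ((a1 * a2 * (b1 * b2)) ^+ m) (del i x) = del ((i + m) %% (4 * n ^ 2).+1) x.
  move=> ni Fx; rewrite wE.
  have -> : ((a1 * b1) ^+ m * (a2 * b2) ^+ m) (del i x) =
    ((a2 * b2) ^+ m) (((a1 * b1) ^+ m) (del i x)) by [].
  rewrite (supp_inX m (supp_inM sa1 sb1)) ?ab2 // => /dspan; apply.
  by exists i => //; exists x.
have Ucase x : U x -> A x /\ x = eps 0 x \/
    exists j y, [/\ j < 4 * n, F y, x = phi j y & x = del (j * n)%N y].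
  move=> Ux; have [Ax|nAx] := pselect (A x); first by left; rewrite eps0.
  have [[j nj [y Fy yx]]|nE] := pselect (exists2 j, j < 4 * n & (phi j @` F) x).
    right; exists j, y; split=> //.
    by rewrite -[(j * n)%N]addn0 delE // eps0 /= yx.
  by case: nAx.
have epsU i x : U x -> U (eps i x) -> i = 0.
  by move=> Ux Uex; apply: (epsd i 0 x (eps i x)) => //; rewrite eps0.
have n0 : 0 < n by [].
(* On copy [j] of F inside [U] the index grows from [j * n] to [j * n + m] without wrapping around,
   so [w ^+ m] agrees with [eps m] on all of [U]. *)
have wU m x : m < n -> U x -> ((a1 * a2 * (b1 * b2)) ^+ m) x = eps m x.
  move=> mn /Ucase[[Ax xE]|[j [y [nj Fy xphi xE]]]].
    by rewrite {1}xE wA // modn_small.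
  rewrite {1}xE wF //; last by nia.
  by rewrite modn_small ?delE -?xphi //; nia.
exists U, (a1 * a2), (b1 * b2); split.
- by split=> //; exists u.
- split; do ?exact: subgroupM.
    by rewrite expgMn ?a12 ?a22 ?mulg1 //; exact: cZ.
  by rewrite expgMn ?b12 ?b22 ?mulg1 //; exact: cZ.
- move=> m /andP[m0 mn] x Ux; rewrite wU // => /(epsU m x Ux) mE.
  by rewrite mE in m0.
- split.
    exists o'; first exact: O'U.
    have e0 : eps 0 o' = o' by rewrite eps0.
    by have := wA n 0 o' n0 Ao; rewrite e0 add0n modnn e0 => ->; exact: O'U.
  (* From index [(4 * n - 1) * n], a shift by [n + 1] wraps around to index 0, which lies in [U]. *)
  exists (phi (4 * n).-1 o); first exact: phiUU.
  have -> : phi (4 * n).-1 o = del ((4 * n).-1 * n)%N o.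
    by rewrite -[((4 * n).-1 * n)%N]addn0 delE ?eps0 //; nia.
  rewrite wF //; last by nia.
  rewrite (_ : _ + _ = (4 * n ^ 2).+1)%N; last by nia.
  rewrite modnn -[0%N](_ : 0 * n + 0 = 0)%N // delE ?eps0 //; exact: phiUU.
- move=> x; have [Fx|/contrapT[i ni [y Uy <-]]] := pselect (F x); last first.
    by exists i; [exact: ltnW|exists y => //; exact: wU].
  (* From the same index, a shift by [n] ends at the last index, which is F itself. *)
  exists n => //; exists (phi (4 * n).-1 x); first exact: phiUU.
  have -> : phi (4 * n).-1 x = del ((4 * n).-1 * n)%N x.
    by rewrite -[((4 * n).-1 * n)%N]addn0 delE ?eps0 //; nia.
  rewrite wF //; last by nia.
  rewrite (_ : _ + _ = 4 * n ^ 2)%N; last by nia.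
  by rewrite modn_small // delF.
Qed.

Lemma double_swaps_image H U h : subgroup H -> H h -> G h ->
  double_swaps U `<=` H -> double_swaps (h @` U) `<=` H.
Proof.
move=> sH Hh Gh HU q hUq; rewrite -(conjgKV h q); apply: (subgroupJ sH) => //.
apply: HU; have := double_swapsJ (subgroupV subgroupG Gh) hUq.
by rewrite -homeo_imageM mulgV image_id.
Qed.

(* Consecutive translates of [U `|` w ^+ n @` U] meet. *)
Lemma covering_generates H U w n : subgroup H -> H w -> G w -> clopen U ->
    double_swaps U `<=` H ->
    (exists2 x, U x & U ((w ^+ n) x)) -> (exists2 x, U x & U ((w ^+ n.+1) x)) ->
    (forall x, exists2 m, m <= n & ((w ^+ m) @` U) x) ->
  G `<=` H.
Proof.
move=> sH Hw Gw cU HU [p Up Uwp] [q Uq Uwq] cover.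
have Hwm m V : double_swaps V `<=` H -> double_swaps ((w ^+ m) @` V) `<=` H.
  by apply: double_swaps_image => //; exact: subgroupX.
set Z := U `|` (w ^+ n) @` U.
have cZ : clopen Z by apply: clopenU => //; exact: clopen_homeo.
have HZ : double_swaps Z `<=` H.
  apply: double_swapsU => //; [exact: clopen_homeo| |exact: Hwm].
  by exists ((w ^+ n) p); split=> //; exists p.
have ZwZ : Z ((w ^+ n.+1) q) /\ (w @` Z) ((w ^+ n.+1) q).
  split; first by left.
  by exists ((w ^+ n) q); [right; exists q|rewrite expgSr].
pose S m := [set x | exists2 i, i < m.+1 & ((w ^+ i) @` Z) x].
have HS m : double_swaps (S m) `<=` H.
  elim: m => [|m IH].
    rewrite (_ : S 0 = Z) //; apply/seteqP; split=> x.
      by move=> [[|//] _ [y Zy <-]].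
    by exists 0 => //; exists x.
  have -> : S m.+1 = S m `|` (w ^+ m.+1) @` Z.
    apply/seteqP; split=> x [].
    - by move=> i; rewrite ltnS leq_eqVlt => /predU1P[->|im] ix; [right|left; exists i].
    - by move=> [i im ix]; exists i => //; exact: ltnW.
    - by move=> [y Zy yx]; exists m.+1 => //; exists y.
  apply: double_swapsU => //.
  - by apply: clopen_exists_lt => i _; exact: clopen_homeo.
  - exact: clopen_homeo.
  - exists ((w ^+ m) ((w ^+ n.+1) q)); split.
      by exists m => //; exists ((w ^+ n.+1) q) => //; case: ZwZ.
    by rewrite expgS homeo_imageM; case: ZwZ => _ wZ; exists ((w ^+ n.+1) q).
  - exact: Hwm.
rewrite -generated_double_swapsT; apply: (generated_sub sH).
apply: subset_trans (HS n); apply: double_swapsS => x _.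
by have [m mn [y Uy yx]] := cover x; exists m => //; exists y => //; left.
Qed.

Lemma generated_three_involutions : finitely_generated G -> exists a b c,
  [/\ involution a, involution b, involution c & G = generated [set a; b; c]].
Proof.
move=> [S0 /finite_seqP[l0 ->] l0G].
(* Four involutions will be spread over [2 ^ 4 = 16] translates; [t = 2] provides 17. *)
have [U [a [b [[cU nU] [Ga Gb a2 b2] wU [Uwn Uwn1] cover]]]] := @covering_rotation 2 isT.
move: wU Uwn Uwn1 cover; set w := a * b; set n := (4 * 2 ^ 2).+1%N => wU Uwn Uwn1 cover.
have Gw : G w by exact: subgroupM.
have GwQ : G `<=` generated ([set w] `|` double_swaps U).
  set H := generated _; have sH : subgroup H by exact: subgroup_generated.
  apply: (covering_generates sH _ Gw cU _ Uwn Uwn1 cover).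
    by apply: sub_generated; left.
  by move=> q Uq; apply: sub_generated; right.
have [|l lU l0l] := @generated_finites _ [set w] (double_swaps U) l0.
  by move=> x xl0; apply: GwQ; rewrite -l0G; exact: sub_generated.
have [l1 l1U ll1] := double_swaps_comm_seq lU.
have [s [sP s0 l1s]] := double_swaps_capture cU nU l1U.
have [|||c [c2 cH cK c1]] := @spread_involution _ U w 4 s.
- by move=> i _; have [] := sP i.
- by move=> i _; have [] := sP i.
- move=> m /andP[m0 m4]; apply: wU; rewrite m0 /=; exact: (leq_trans m4).
have [u Uu] := nU.
(* If [a] or [b] were trivial, [w] would be the other one and have trivial square. *)
have w2 : w ^+ 2 <> 1.
  by move=> w21; apply: (wU 2 isT u Uu); rewrite w21.
exists a, b, c; split.
- by split=> // a1; apply: w2; rewrite /w a1 mul1g.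
- by split=> // b1; apply: w2; rewrite /w b1 mulg1.
- by split=> //; exact: (c1 0).
have Gc : G c by apply: cH => // i _; have [] := sP i.
apply/seteqP; split; last first.
  by apply: generated_sub => // x [[->|->]|->].
set K := generated _; have sK : subgroup K by exact: subgroup_generated.
have Kw : K w.
  by apply: (subgroupM sK); apply: sub_generated; left; [left|right].
have Kc : K c by apply: sub_generated; right.
rewrite -l0G; apply: (generated_sub sK); apply: (subset_trans l0l).
apply: (generated_sub sK) => q [->//|/= ql].
have [x [y [xl yl ->]]] := ll1 q ql.
by apply: cK => //; exact: l1s.
Qed.

End Vigorous.

(** * The Cantor space *)

Lemma cantor_space_split (O : set cantor_space) : clopen O -> O !=set0 ->
  exists V, [/\ clopen V, V `<=` O, V !=set0 & (O `\` V) !=set0].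
Proof.
move=> cO [x Ox].
(* Otherwise [O] would be the open singleton of [x], an isolated point of a perfect space. *)
have [y Oy yx] : exists2 y, O y & x != y.
  apply: contrapT => nE; apply: (perfectTP.1 cantor_perfect x).
  rewrite (_ : [set x] = O); first by case: cO.
  apply/seteqP; split=> [_ ->//|y Oy]; apply: contrapT => /eqP yx.
  by apply: nE; exists y => //; rewrite eq_sym.
have [V [cV Vx Vy]] := cantor_zero_dimensional yx.
exists (O `&` V); split; [exact: clopenI|by move=> z []|by exists x|].
by exists y; split=> // -[].
Qed.

Theorem theorem4 (G : set (homeo cantor_space)) :
  subgroup G -> finitely_generated G -> simple_group G -> vigorous G ->
  exists a b c : homeo cantor_space,
    [/\ involution a, involution b, involution c & G = generated [set a; b; c]].
Proof.
move=> sG fG simpG vG.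
exact: (generated_three_involutions cantor_space_compact cantor_space_split).
Qed.
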